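(* Suppose $G$ is a locally compact recurrent group. Then any closed subgroup of $G$ is unimodular. In particular, if $g\in G$ and $C_g$ is closed, then $C_g=\{e\}$.
   Context: Groups are locally compact and second countable. For $g\in G$, $C_g=\{x\in G\mid\lim_{n\to\infty}g^nxg^{-n}=e\}$. For a Borel probability measure $\mu$ on $G$, let $Y_1,Y_2,\dots$ be i.i.d. of law $\mu$ and $X_n=Y_n\cdots Y_1$. The measure $\mu$ is recurrent if for every neighborhood $W$ of $e$, almost surely $X_n\in W$ for infinitely many $n$; $\mu$ is adapted if the smallest closed subgroup of $G$ containing the support of $\mu$ is $G$. The group $G$ is recurrent if there exists an adapted recurrent Borel probability measure on $G$. *)

(* Defs.v *)
From HB Require Import structures.
From mathcomp Require Import all_boot all_order all_algebra finmap.
From mathcomp Require Import all_classical all_reals all_analysis.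

Set Implicit Arguments.
Unset Strict Implicit.
Unset Printing Implicit Defensive.

Local Open Scope classical_set_scope.
Local Open Scope ring_scope.
Local Open Scope group_scope.

HB.structure Definition PreTopologicalGroup :=
  {G of PointedTopological G & Group G}.

HB.mixin Record PreTopologicalGroup_isTopologicalGroup G
    of PreTopologicalGroup G := {
  mulg_continuous : continuous (fun x : G * G => x.1 * x.2);
  invg_continuous : continuous (fun x : G => x^-1)
}.

(* The distinguished point carried by [Pointed] plays no role: it is only there
   because [g_sigma_algebraType] requires a pointed carrier. *)
#[short(type="topGroupType")]
HB.structure Definition TopologicalGroup :=
  {G of PreTopologicalGroup G & PreTopologicalGroup_isTopologicalGroup G}.

Definition lcsc (G : topologicalType) : Prop :=
  [/\ hausdorff_space G, locally_compact [set: G] & @second_countable G].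

Notation borel G := (g_sigma_algebraType (@open G)).

Definition subgroup (G : groupType) (H : set G) : Prop := group_closed [in H].

(* The closure proof is an argument so that the group structure can be inferred
   from the type; the topology is the one induced by [G]. *)
Definition subgroup_type (G : topGroupType) (H : set G) of subgroup H : Type :=
  set_type H.

Section subgroup_type_structure.
Context (G : topGroupType) (H : set G) (sgH : subgroup H).
Local Notation S := (subgroup_type sgH).

HB.instance Definition _ := SubChoice.on S.
HB.instance Definition _ := Topological.copy S (set_type H).
HB.instance Definition _ := SubChoice_isSubGroup.Build G [in H] S sgH.
HB.instance Definition _ := isPointed.Build S 1.

Let val_continuous : continuous (val : S -> G).
Proof. exact: (@initial_continuous (set_type H) G set_val). Qed.

Let mul_continuous : continuous (fun x : S * S => x.1 * x.2).
Proof.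
apply: (@continuous_comp_initial (set_type H) (S * S)%type G set_val) => x.
rewrite [_ \o _](_ : _ = fun z : S * S => val z.1 * val z.2); last first.
  by apply/funext => z; exact: (@valM G [in H] S).
apply: (@continuous_comp _ _ _ (fun z : S * S => (val z.1, val z.2))
  (fun z : G * G => z.1 * z.2)); last exact: mulg_continuous.
apply: cvg_pair => /=.
- apply: (@continuous_comp (S * S)%type S G fst (val : S -> G)).
    exact: cvg_fst.
  exact: val_continuous.
- apply: (@continuous_comp (S * S)%type S G snd (val : S -> G)).
    exact: cvg_snd.
  exact: val_continuous.
Qed.

Let inv_continuous : continuous (fun x : S => x^-1).
Proof.
apply: (@continuous_comp_initial (set_type H) S G set_val) => x.
rewrite [_ \o _](_ : _ = fun z : S => (val z)^-1); last first.
  by apply/funext => z; exact: (gmulfV (val : S -> G)).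
apply: (@continuous_comp S G G (val : S -> G) (fun z : G => z^-1)).
  exact: val_continuous.
exact: invg_continuous.
Qed.

HB.instance Definition _ :=
  PreTopologicalGroup_isTopologicalGroup.Build S mul_continuous inv_continuous.

End subgroup_type_structure.

Section haar.
Context (R : realType) (G : topGroupType).
Local Open Scope ereal_scope.
Implicit Type mu : {measure set (borel G) -> \bar R}.

Definition left_invariant mu : Prop :=
  forall (g : G) (A : set (borel G)), measurable A ->
    mu [set (g * x)%g | x in A] = mu A.

Definition right_invariant mu : Prop :=
  forall (g : G) (A : set (borel G)), measurable A ->
    mu [set (x * g)%g | x in A] = mu A.

(* Regularity is not required: on a locally compact second countable Hausdorff
   space it follows from finiteness on compact sets. *)
Definition left_haar mu : Prop :=
  [/\ left_invariant mu,
      forall K : set G, compact K -> mu K < +oo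
    & mu [set: borel G] != 0].

Definition unimodular : Prop := forall mu, left_haar mu -> right_invariant mu.

End haar.

Section random_walk.
Context (R : realType) (G : topGroupType).
Implicit Type mu : probability (borel G) R.

Definition support mu : set G :=
  [set x | forall U : set G, open_nbhs x U -> (0 < mu U)%E].

Definition adapted mu : Prop :=
  smallest [set H : set G | closed H /\ subgroup H] (support mu) = [set: G].

Section realization.
Context (d : measure_display) (Omega : measurableType d)
  (P : probability Omega R) (Y : nat -> {RV P >-> borel G}).

Definition independent : Prop :=
  forall (J : {fset nat}) (B : nat -> set (borel G)),
    (forall i, measurable (B i)) ->
    P (\bigcap_(i in [set` J]) (Y i @^-1` B i)) =
    (\prod_(i <- J) P (Y i @^-1` B i))%E.

Definition iid_of_law mu : Prop :=
  independent /\
  forall n (A : set (borel G)), measurable A -> distribution P (Y n) A = mu A.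

(* [Y] is indexed from 0: [walk n = Y n.-1 * ... * Y 0]. *)
Fixpoint walk (n : nat) (w : Omega) : G :=
  if n is m.+1 then (Y m w : G) * walk m w else 1.

Definition recurrent_walk : Prop :=
  forall W : set G, nbhs 1 W ->
    {ae P, forall w, forall N, exists2 n, (N <= n)%N & W (walk n w)}.

End realization.

(* Recurrence depends only on the law of the sequence [Y], hence only on [mu];
   it can therefore be tested on any one realization. *)
Definition recurrent_measure mu : Prop :=
  exists (d : measure_display) (Omega : measurableType d)
    (P : probability Omega R) (Y : nat -> {RV P >-> borel G}),
    iid_of_law Y mu /\ recurrent_walk Y.

Definition recurrent_group : Prop :=
  exists mu, adapted mu /\ recurrent_measure mu.

End random_walk.

Definition contracted (G : topGroupType) (g : G) : set G :=
  [set x | (fun n : nat => g ^+ n * x * g ^- n) @ \oo --> (1 : G)].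

(* Main.v *)
Require Import Defs.
From HB Require Import structures.
From mathcomp Require Import all_boot all_order all_algebra finmap.
From mathcomp Require Import all_classical all_reals all_analysis.
From mathcomp Require Import measurable_realfun.
From mathcomp Require Import lra.

(** Let [mu] be an adapted recurrent law on G, and for 0 < a < 1 let s be the
potential of [mu] discounted by a, the finite measure whose value at A is the
sum over n of a^n mu^n(A). Everything rests on a Harnack inequality
([potential_harnack]): there are a neighbourhood W of 1 and a constant C such
that, for each h in G, if a is close enough to 1 then
  s (W^2 h^-1 x^-1) <= C s (W^2 x^-1) for all x in G.
How close a must be to 1 depends on h, but C does not.

Its proof starts from the fact that the walk almost surely visits every
nonempty open set ([hits_sure]). As s is superharmonic for the translations by
the steps of the walk, up to a factor 2 it exceeds the infimum of the values
s (A z^-1) for z in a given nonempty open set, once a is close to 1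
([reach_r]); the inverse walk gives the same for z^-1 A ([reach_l_unif]). So s
is almost invariant on both sides, up to factors 2 and small enlargements of
the sets. A double counting then compares the measures s and s (. x^-1); it is
the computation which shows that a left invariant measure on a group carrying
a bi-invariant one is right invariant, and the loss of constants in it does
not depend on h.

Let m be a left Haar measure on a closed subgroup H. By uniqueness of Haar
measure, right translation by h in H multiplies m by a factor c
([haar_modular]). The integral over H of s (W^2 x^-1) against m is finite and
positive, and translation by h^n multiplies it by c^n; by the Harnack
inequality for h^n, c^n <= C for all n, whence c <= 1 ([modular_le1]). This
applied to h^-1 too gives c = 1.

Suppose that the contraction group of g is closed and not trivial. A Baire
category argument shows that conjugation by a large power h of g contracts its
compact subsets uniformly ([uniform_contraction]). Pick M >= 2 C elements x_i
of the contraction group close to 1. If h is a high enough power of g, the M^J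
products of J factors of the form x_i h are so far apart that the sets
W^2 p^-1, p such a product, are disjoint, and their masses add up to at most
s(G). On the other hand, J applications of the Harnack inequality show that
each mass is at least C^-J. So M^J <= C^J s(G) for all J, which is absurd
([contracted_trivial]). *)

Set Implicit Arguments.
Unset Strict Implicit.
Unset Printing Implicit Defensive.

Import Order.TTheory GRing.Theory Num.Theory.
Import numFieldNormedType.Exports.
Local Open Scope classical_set_scope.
Local Open Scope ring_scope.
Local Open Scope group_scope.

(** * Translates and product sets in a topological group *)

Section continuity.
Context (G : topGroupType).

Lemma cvgMg (T : Type) (F : set_system T) {FF : Filter F} (f g : T -> G) (a b : G) :
  f @ F --> a -> g @ F --> b -> (fun t => f t * g t) @ F --> a * b.
Proof.
move=> fa gb; apply: (@cvg_comp _ _ _ (fun t => (f t, g t))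
  (fun z : G * G => z.1 * z.2) _ (nbhs (a, b))); first exact: cvg_pair.
exact: (@mulg_continuous G (a, b)).
Qed.

Lemma cvgVg (T : Type) (F : set_system T) {FF : Filter F} (f : T -> G) (a : G) :
  f @ F --> a -> (fun t => (f t)^-1) @ F --> a^-1.
Proof. by move=> fa; apply: cvg_comp; [exact: fa|exact: invg_continuous]. Qed.

Lemma continuousMg (T : topologicalType) (f g : T -> G) :
  continuous f -> continuous g -> continuous (fun t => f t * g t).
Proof. by move=> fc gc t; apply: cvgMg; [exact: fc|exact: gc]. Qed.

Lemma continuous_mull (x : G) : continuous (fun y : G => x * y).
Proof. by apply: continuousMg => ?; [exact: cvg_cst|exact: cvg_id]. Qed.

Lemma continuous_mulr (x : G) : continuous (fun y : G => y * x).
Proof. by apply: continuousMg => ?; [exact: cvg_id|exact: cvg_cst]. Qed.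

(** Translates are encoded as preimages, along which openness and
measurability pass directly: the three sets are A x^-1, x^-1 A and A^-1. *)
Definition rtrans (A : set G) (x : G) : set G := [set y | A (y * x)].
Definition ltrans (A : set G) (x : G) : set G := [set y | A (x * y)].
Definition invs (A : set G) : set G := [set y | A y^-1].

Lemma rtransM A x y : rtrans (rtrans A x) y = rtrans A (y * x).
Proof. by apply/seteqP; split => z; rewrite /rtrans /= mulgA. Qed.

Lemma rtrans1 A : rtrans A 1 = A.
Proof. by apply/seteqP; split => z; rewrite /rtrans /= mulg1. Qed.

Lemma open_rtrans A x : open A -> open (rtrans A x).
Proof. by move=> oA; apply: open_comp => // y _; exact: continuous_mulr. Qed.

Lemma open_ltrans A x : open A -> open (ltrans A x).
Proof. by move=> oA; apply: open_comp => // y _; exact: continuous_mull. Qed.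

Lemma invsK A : invs (invs A) = A.
Proof. by apply/seteqP; split => x; rewrite /invs /= invgK. Qed.

Lemma open_invs A : open A -> open (invs A).
Proof. by move=> oA; apply: open_comp => // y _; exact: invg_continuous. Qed.

Lemma nbhs_mulg (x y : G) (A : set G) : nbhs (x * y) A ->
  exists B C, [/\ open_nbhs x B, open_nbhs y C & forall b c, B b -> C c -> A (b * c)].
Proof.
move=> /(@mulg_continuous G (x, y)) [[B C] /= [nB nC]] BC.
move: nB nC; rewrite !nbhsE => -[B' oB B'B] [C' oC C'C].
exists B', C'; split => // b c /B'B Bb /C'C Cc.
exact: (BC (b, c)).
Qed.

(** The set W^n of the products of n elements of W. *)
Fixpoint setpow (W : set G) n : set G :=
  if n is m.+1 then [set z | exists2 w, W w & setpow W m (w^-1 * z)] else [set 1].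

Lemma setpowM (W : set G) m n x y : setpow W m x -> setpow W n y -> setpow W (m + n) (x * y).
Proof.
elim: m x => [x /= -> |m IH x /= [w Ww xm] yn]; first by rewrite mul1g.
by exists w => //; rewrite mulgA; exact: IH.
Qed.

Lemma setpow1 (W : set G) x : W x -> setpow W 1 x.
Proof. by move=> Wx; exists x => //=; rewrite mulVg. Qed.

Lemma setpowS (W : set G) n x : W 1 -> setpow W n x -> setpow W n.+1 x.
Proof. by move=> W1 xn; exists 1 => //=; rewrite invg1 mul1g. Qed.

Lemma setpow_le (W : set G) m n x : W 1 -> (m <= n)%N -> setpow W m x -> setpow W n x.
Proof.
move=> W1 /subnK <-; elim: (n - m)%N => //= k IH xm.
by apply: setpowS => //; exact: IH.
Qed.

Lemma setpowV (W : set G) n x : (forall w, W w -> W w^-1) ->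
  setpow W n x -> setpow W n x^-1.
Proof.
move=> Wi; elim: n x => [x ->|n IH x /= [w Ww xn]]; first by rewrite invg1.
have := setpowM (IH _ xn) (setpow1 (Wi _ Ww)).
by rewrite addn1 invgM invgK mulgK.
Qed.

Lemma setpow_open (W : set G) n : open W -> open (setpow W n.+1).
Proof.
move=> oW; elim: n => [|n IH].
  rewrite (_ : setpow W 1 = W)//; apply/seteqP; split=> x; last exact: setpow1.
  by move=> /= [w Ww /eqP]; rewrite mulg_eq1 eqg_inv => /eqP <-.
rewrite (_ : setpow W n.+2 = \bigcup_(w in W) ltrans (setpow W n.+1) w^-1).
  by apply: bigcup_open => w _; exact: open_ltrans.
by apply/seteqP; split=> x [w Ww xw]; exists w.
Qed.

Lemma sym_nbhs (A : set G) : nbhs 1 A ->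
  exists W, [/\ open W, W 1, forall w, W w -> W w^-1 & W `<=` A].
Proof.
rewrite nbhsE => -[B [oB B1] BA].
exists (B `&` [set y | B y^-1]); split.
- by apply: openI => //; exact: open_invs.
- by split => //=; rewrite invg1.
- by move=> w [Bw Bw'] /=; rewrite invgK.
- by move=> w [/BA].
Qed.

Lemma setpow_nbhs n (A : set G) : nbhs 1 A ->
  exists W, [/\ open W, W 1, forall w, W w -> W w^-1 & setpow W n `<=` A].
Proof.
elim: n A => [|n IH] A nA.
  have [W [? ? ? ?]] := sym_nbhs nA; exists W; split => //= x -> .
  exact: nbhs_singleton nA.
have : nbhs (1 * 1) A by rewrite mulg1.
move=> /nbhs_mulg[B [C [oB oC BC]]].
have [W [oW W1 Wi WB]] : exists W, [/\ open W, W 1, forall w, W w -> W w^-1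
    & setpow W n `<=` C].
  by apply: IH; exact: open_nbhs_nbhs.
have [V [oV V1 Vi VB]] : exists W, [/\ open W, W 1, forall w, W w -> W w^-1
    & W `<=` B].
  by apply: sym_nbhs; exact: open_nbhs_nbhs.
exists (W `&` V); split; [exact: openI|by split|
  by move=> w [/Wi ? /Vi ?]|].
have sub : setpow (W `&` V) n `<=` setpow W n.
  elim: (n) => //= k IHk x [w [Ww _] /IHk xk]; by exists w.
move=> x /= [w [_ /VB Bw] /sub/WB Cx].
by have := BC _ _ Bw Cx; rewrite mulVKg.
Qed.

End continuity.
Arguments setpow : simpl never.

(** * Locally compact second countable spaces *)

Section lcsc_topology.

Lemma lc_nbhs (T : topologicalType) (x : T) : locally_compact [set: T] ->
  exists K, nbhs x K /\ compact K.
Proof.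
move=> /(_ x I)[K] nK [cK _]; exists K; split => //.
by move: nK; rewrite /within /=; apply: filterS => y; exact.
Qed.

Lemma second_countableP (T : topologicalType) : @second_countable T ->
  exists b : nat -> set T, (forall n, open (b n)) /\
    forall x A, nbhs x A -> exists n, b n x /\ b n `<=` A.
Proof.
move=> [B cB [Bo Bx]].
have [B0|] := eqVneq B set0.
  exists (fun=> set0); split; first by move=> _; exact: open0.
  move=> x A nA; have [U [/=]] := Bx x A nA; by rewrite B0.
move=> /set0P B0; case: (pfcard_geP cB) => [B0'|[f]]; first by case: B0 => y; rewrite B0'.
exists f; split.
  by move=> n; apply: Bo; exact: funS.
move=> x A nA; have [U [/= BU Ux] UA] := Bx x A nA.
have [n _ fn] := @surj _ _ _ _ f U BU.
by exists n; rewrite fn.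
Qed.

Lemma lindelof (T : topologicalType) (P : set T -> Prop) :
  @second_countable T -> P set0 ->
  (forall A B, B `<=` A -> P A -> P B) ->
  (forall x : T, exists2 A, nbhs x A & P A) ->
  exists f : nat -> set T, [/\ forall n, open (f n),
     forall n, P (f n) & \bigcup_n f n = setT].
Proof.
move=> /second_countableP[b [bo bx]] P0 PS PT.
exists (fun n => if `[< P (b n) >] then b n else set0); split.
- by move=> n; case: ifP => // _; exact: open0.
- by move=> n; case: ifP => // /asboolP.
- apply/seteqP; split=> // x _; have [A nA PA] := PT x.
  have [n [bnx bnA]] := bx _ _ nA; exists n => //.
  by rewrite asboolT//; exact: PS PA.
Qed.

Lemma lcsc_exhaustion (T : topologicalType) :
  locally_compact [set: T] -> @second_countable T ->
  exists f : nat -> set T, [/\ forall n, open (f n),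
     forall n, (exists2 K, compact K & f n `<=` K) & \bigcup_n f n = setT].
Proof.
move=> lcT scT; apply: (@lindelof T (fun A => exists2 K, compact K & A `<=` K)) => //.
- by exists set0 => //; exact: compact0.
- by move=> A B BA [K cK AK]; exists K => //; exact: subset_trans AK.
- move=> x; have [K [nK cK]] := lc_nbhs x lcT.
  by exists K => //; exists K.
Qed.

(** Second countability is what brings open subsets of a product into the
product of the Borel sigma-algebras. *)
Lemma open_prod_bigcup (S T : topologicalType) (O : set (S * T)) :
  @second_countable S -> @second_countable T -> open O ->
  exists (f : nat -> set S) (g : nat -> set T),
    [/\ forall n, open (f n), forall n, open (g n) &
        O = \bigcup_n (f n `*` g n)].
Proof.
move=> /second_countableP[b [bo bx]] /second_countableP[c [co cx]] oO.
pose h (n : nat) : nat * nat := odflt (0, 0)%N (choice.unpickle n).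
pose P n := b (h n).1 `*` c (h n).2 `<=` O.
exists (fun n => if `[< P n >] then b (h n).1 else set0).
exists (fun n => if `[< P n >] then c (h n).2 else set0); split.
- by move=> n; case: ifP => // _; exact: open0.
- by move=> n; case: ifP => // _; exact: open0.
- apply/seteqP; split=> [[x y] Oxy|z [n _]].
    have [[A B] [/= nA nB] AB] : nbhs (x, y) O by exact: open_nbhs_nbhs.
    have [i [bi biA]] := bx _ _ nA; have [j [cj cjB]] := cx _ _ nB.
    exists (choice.pickle (i, j)) => //=.
    have Pij : P (choice.pickle (i, j)).
      rewrite /P /h choice.pickleK /= => -[u v] [/= /biA Au /cjB Bv].
      exact: (AB (u, v)).
    by rewrite asboolT// /h choice.pickleK.
  by case: asboolP => [Pn|_ []//]; exact: Pn.
Qed.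

Lemma hausdorff_sep (T : topologicalType) (x y : T) :
  hausdorff_space T -> x != y -> exists2 A, nbhs x A & ~ A y.
Proof.
move=> hT xy; move: hT; rewrite open_hausdorff => /(_ _ _ xy)[[A B] /= [xA yB] [oA oB +]].
move=> /eqP AB; exists A; first by apply: open_nbhs_nbhs; split => //; rewrite inE in xA.
move=> Ay; have : (A `&` B) y by split => //; rewrite inE in yB.
by rewrite AB.
Qed.

(** Baire's theorem for a closed subset C of a locally compact space: if no
[F n] contained a nonempty relatively open part of C, one could choose
decreasing relatively compact open sets meeting C, the closure of the n-th one
avoiding [F n]; by compactness their closures would share a point of C, which
lies in some [F n]. *)
Lemma baire_closed (T : topologicalType) (C : set T) (F : nat -> set T) :
  hausdorff_space T -> locally_compact [set: T] ->
  C !=set0 -> closed C -> (forall n, closed (F n)) -> C `<=` \bigcup_n F n ->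
  exists n U, [/\ open U, U `&` C !=set0 & U `&` C `<=` F n].
Proof.
move=> hT lcT [x0 Cx0] clC clF CF.
apply: contrapT => noint.
have step n (U : set T) : open U -> U `&` C !=set0 ->
  exists V, [/\ open V, V `&` C !=set0, closure V `<=` U `&` ~` F n &
    compact (closure V)].
  move=> oU UC.
  have [x [Ux Cx nFx]] : exists x, [/\ U x, C x & ~ F n x].
    apply: contrapT => nx; apply: noint; exists n, U; split => // x [Ux Cx].
    by apply: contrapT => Fx; apply: nx; exists x.
  have [K [nK cK]] := lc_nbhs x lcT.
  have nUF : nbhs x (U `&` ~` F n).
    apply: filterI; first exact: open_nbhs_nbhs.
    by apply: open_nbhs_nbhs; split => //; exact: closed_openC.
  have [B nB BU] := compact_regular hT cK nK nUF.
  have nBK : nbhs x (B `&` K) by exact: filterI.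
  move: (nBK); rewrite nbhsE => -[V [oV Vx] VBK].
  exists V; split => //.
  - by exists x.
  - apply: subset_trans BU; apply: closureS.
    by apply: subset_trans VBK _ => z [].
  - apply: (subclosed_compact _ cK); first exact: closed_closure.
    move: (compact_closed hT cK) => /closure_id ->; apply: closureS.
    by apply: subset_trans VBK _ => z [].
pose good (U : set T) := open U /\ U `&` C !=set0.
have step' (p : nat * set T) : exists V, good p.2 ->
    [/\ good V, closure V `<=` p.2 `&` ~` F p.1 & compact (closure V)].
  case: p => n U /=; have [gU|] := pselect (good U); last by exists setT.
  have [V [oV VC VU cV]] := step n U gU.1 gU.2.
  by exists V.
have [f fP] := choice step'.
pose V := fix V n := if n is m.+1 then f (m, V m) else setT.
have gV n : good (V n).
  elim: n => [|n IH] /=; last by have [] := fP (n, V n) IH.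
  by split; [exact: openT|exists x0].
have VS n : closure (V n.+1) `<=` V n `&` ~` F n by have [] := fP (n, V n) (gV n).
have cV n : compact (closure (V n.+1)) by have [] := fP (n, V n) (gV n).
have Vd m n : (m <= n)%N -> V n `<=` V m.
  move=> /subnK <-; elim: (n - m)%N => //= k IH.
  apply: subset_trans IH => y Vy.
  by have [] := VS (k + m)%N _ (subset_closure Vy).
(* a cluster point of a sequence of points of V n and C lies in all closures *)
have VC n : exists y, (V n `&` C) y by case: (gV n).
have [s sP] := choice VC.
have := cV 0%N (s @ \oo) _; case.
  exists 1%N => // n /= n1; apply: subset_closure; apply: Vd n1 _ _.
  by have [] := sP n.
move=> y [_ sy].
have yV n : closure (V n `&` C) y.
  move=> B nB; apply: (sy (V n `&` C) B _ nB).
  by exists n => // k /= nk; have [Vk Ck] := sP k; split => //; exact: Vd nk _ Vk.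
have Cy : C y.
  by move/closure_id: clC => ->; apply: closureS (yV 0%N) => z [].
have [n _ Fny] := CF _ Cy.
have : closure (V n.+1) y by apply: closureS (yV n.+1) => z [].
by move=> /VS[_]; exact.
Qed.

End lcsc_topology.

(** * Borel measurability of the group operations *)

Lemma open_borel (T : ptopologicalType) (A : set T) : open A -> measurable (A : set (borel T)).
Proof. by move=> oA; exact: sub_sigma_algebra. Qed.

Section borel_sets.
Context (S T U : ptopologicalType).

Lemma continuous_borel (f : S -> T) : continuous f ->
  measurable_fun [set: borel S] (f : borel S -> borel T).
Proof.
move=> fc; apply: (@measurability _ _ (borel S) (borel T) setT f (@open T)) => //.
move=> _ [A oA <-]; rewrite setTI; apply: open_borel.
by apply: open_comp => // x _; exact: fc.
Qed.

Hypothesis (scS : @second_countable S) (scT : @second_countable T).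

Lemma open_borel_prod (A : set (S * T)) : open A ->
  measurable (A : set (borel S * borel T)).
Proof.
move=> /(open_prod_bigcup scS scT)[f [g [fo go ->]]].
by apply: bigcup_measurable => n _; apply: measurableX; exact: open_borel.
Qed.

Lemma continuous_borel_prod (f : S * T -> U) : continuous f ->
  measurable_fun [set: borel S * borel T] (f : borel S * borel T -> borel U).
Proof.
move=> fc; apply: (@measurability _ _ (borel S * borel T)%type (borel U) setT f (@open U)) => //.
move=> _ [A oA <-]; rewrite setTI; apply: open_borel_prod.
by apply: open_comp => // x _; exact: fc.
Qed.

End borel_sets.

Section borel_translates.
Context (G : topGroupType).
Local Notation B := (borel G).

Lemma measurable_ltrans (A : set B) (g : G) : measurable A -> measurable (ltrans A g : set B).
Proof.
move=> mA; have := continuous_borel (@continuous_mull G g).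
by move=> /(_ measurableT _ mA); rewrite setTI.
Qed.

Lemma measurable_rtrans (A : set B) (g : G) : measurable A -> measurable (rtrans A g : set B).
Proof.
move=> mA; have := continuous_borel (@continuous_mulr G g).
by move=> /(_ measurableT _ mA); rewrite setTI.
Qed.

End borel_translates.

(** * Hitting probabilities *)

Section hitting.
Context (R : realType) (G : topGroupType) (lcscG : lcsc G).
Local Notation B := (borel G).
Local Open Scope ereal_scope.

Let scG : @second_countable G. Proof. by case: lcscG. Qed.

Lemma mul_borel : measurable_fun [set: B * B]
  ((fun z : G * G => (z.1 * z.2)%g) : B * B -> B).
Proof. apply: continuous_borel_prod => //; exact: mulg_continuous. Qed.

Variable mu : probability B R.

(** The Markov operator of the walk which multiplies by its steps on the left. *)
Definition avg (f : B -> \bar R) (x : B) : \bar R :=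
  \int[mu]_z f ((z : G) * (x : G))%g.

Lemma measurable_avg (f : B -> \bar R) :
  measurable_fun setT f -> (forall x, 0 <= f x) -> measurable_fun setT (avg f).
Proof.
move=> mf f0.
apply: (@measurable_fun_fubini_tonelli_G _ _ B B R mu
  (fun z => f ((z.1 : G) * (z.2 : G))%g)) => //.
exact: (measurableT_comp mf mul_borel).
Qed.

Lemma measurable_mulr (f : B -> \bar R) (x : G) :
  measurable_fun setT f -> measurable_fun [set: B] (fun z : B => f ((z : G) * x)%g).
Proof.
move=> mf; have mx := continuous_borel (@continuous_mulr G x).
exact: (measurableT_comp mf mx).
Qed.

Lemma avg_ge0 f x : (forall x, 0 <= f x) -> 0 <= avg f x.
Proof. by move=> f0; exact: integral_ge0. Qed.

Lemma le_avg f g x : measurable_fun setT f -> measurable_fun setT g ->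
  (forall x, 0 <= f x) -> (forall x, f x <= g x) -> avg f x <= avg g x.
Proof.
move=> mf mg f0 fg; apply: ge0_le_integral => //.
- exact: measurable_mulr.
- exact: measurable_mulr.
Qed.

Lemma avg_cst (c : \bar R) x : avg (cst c) x = c.
Proof.
rewrite /avg integral_cst//; transitivity (c * 1); last exact: mule1.
by congr (_ * _); exact: probability_setT.
Qed.

Lemma avgD f g x : measurable_fun setT f -> measurable_fun setT g ->
  (forall x, 0 <= f x) -> (forall x, 0 <= g x) ->
  avg (fun y => f y + g y) x = avg f x + avg g x.
Proof.
by move=> mf mg f0 g0; rewrite /avg ge0_integralD//; exact: measurable_mulr.
Qed.

Lemma avgZ f (c : R) x : measurable_fun setT f ->
  (forall x, 0 <= f x) -> (0 <= c)%R -> avg (fun y => c%:E * f y) x = c%:E * avg f x.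
Proof.
by move=> mf f0 c0; rewrite /avg ge0_integralZl//; exact: measurable_mulr.
Qed.

Lemma avgMr f x g : avg f (x * g)%g = avg (fun y : B => f ((y : G) * g)%g) x.
Proof. by apply: eq_integral => z _; rewrite mulgA. Qed.

(** The probability that the walk started at x visits D within n steps. *)
Fixpoint hit (D : set G) (n : nat) (x : B) : \bar R :=
  if (x : G) \in D then 1 else if n is m.+1 then avg (hit D m) x else 0.

Lemma hit_ge0 D n x : 0 <= hit D n x.
Proof.
elim: n x => [|n IH] x /=; case: ifP => // _.
exact: avg_ge0.
Qed.

Lemma measurable_hit D n : open D -> measurable_fun setT (hit D n).
Proof.
move=> oD; elim: n => [|n IH] /=.
  apply: measurable_fun_ifT => //.
  apply: (@measurable_fun_bool _ B _ _ true).
  rewrite setTI (_ : _ @^-1` _ = D); first exact: open_borel.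
  by apply/seteqP; split => x /=; [move=> /set_mem|move/mem_set].
apply: measurable_fun_ifT => //.
  apply: (@measurable_fun_bool _ B _ _ true).
  rewrite setTI (_ : _ @^-1` _ = D); first exact: open_borel.
  by apply/seteqP; split => x /=; [move=> /set_mem|move/mem_set].
by apply: measurable_avg => //; exact: hit_ge0.
Qed.

Lemma hit_le1 D n x : open D -> hit D n x <= 1.
Proof.
move=> oD; elim: n x => [|n IH] x /=; case: ifP => // _.
rewrite -[leRHS](avg_cst 1 x); apply: le_avg => //; first exact: measurable_hit.
exact: hit_ge0.
Qed.

Lemma hit_nd D n x : open D -> hit D n x <= hit D n.+1 x.
Proof.
move=> oD; elim: n x => [|n IH] x /=; case: ifP => // _.
  by apply: avg_ge0 => y; exact: (hit_ge0 D 0 y).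
apply: le_avg => //; [exact: measurable_hit|exact: (measurable_hit n.+1)|exact: hit_ge0].
Qed.

Lemma hit_mulr D n x g : hit D n (x * g)%g = hit (rtrans D g) n x.
Proof.
elim: n x => [|n IH] x /=; rewrite (_ : ((x * g)%g \in D) = (x \in rtrans D g)) //.
case: ifP => // _; rewrite avgMr; congr (avg _ x); apply/funext => y; exact: IH.
Qed.

Lemma le_hit D E n x : open D -> open E -> D `<=` E -> hit D n x <= hit E n x.
Proof.
move=> oD oE DE; elim: n x => [|n IH] x /=; case: ifPn => xD.
- by rewrite ifT//; apply/mem_set/DE/set_mem.
- by case: ifPn => // _; exact: lee01.
- by rewrite ifT//; apply/mem_set/DE/set_mem.
- case: ifPn => // _; last first.
    by apply: le_avg => //; [exact: measurable_hit|exact: measurable_hit|exact: hit_ge0].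
  rewrite -[leRHS](avg_cst 1 x); apply: le_avg => //; first exact: measurable_hit.
    exact: hit_ge0.
  by move=> y; exact: hit_le1.
Qed.

(** At the first visit to D the function is at least c, and superharmonicity
carries this bound back to the starting point; each of the at most n steps
costs a factor a. *)
Lemma min_principle (v : B -> \bar R) (a c : R) (D : set G) n x :
  open D -> measurable_fun setT v -> (forall x, 0 <= v x) ->
  (0 <= a <= 1)%R -> (0 <= c)%R ->
  (forall x, a%:E * avg v x <= v x) -> (forall x, D x -> c%:E <= v x) ->
  (a ^+ n * c)%R%:E * hit D n x <= v x.
Proof.
move=> oD mv v0 /andP[a0 a1] c0 av cv; elim: n x => [|n IH] x /=.
  case: ifPn => [/set_mem xD|_]; last by rewrite mule0.
  by rewrite expr0 mul1r mule1; exact: cv.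
case: ifPn => [/set_mem xD|_].
  rewrite mule1; apply: le_trans (cv _ xD).
  by rewrite lee_fin ler_piMl// exprn_ile1.
apply: le_trans (av x); rewrite exprS -mulrA EFinM -muleA lee_wpmul2l//.
rewrite -avgZ//; last 3 first.
  exact: measurable_hit.
  exact: hit_ge0.
  by rewrite mulr_ge0// exprn_ge0.
apply: le_avg => //.
- by apply: measurable_funeM; exact: measurable_hit.
- by move=> y; rewrite mule_ge0// ?hit_ge0// lee_fin mulr_ge0// exprn_ge0.
Qed.

(** A subharmonic function bounded by 1 which stays below 1 by c on D must
already be below 1 at x, by c times the probability of reaching D. *)
Lemma max_principle (f : B -> \bar R) (c : R) (D : set G) n x :
  open D -> measurable_fun setT f -> (forall x, 0 <= f x) -> (0 <= c)%R ->
  (forall x, f x <= 1) -> (forall x, f x <= avg f x) ->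
  (forall x, D x -> f x + c%:E <= 1) ->
  f x + c%:E * hit D n x <= 1.
Proof.
move=> oD mf f0 c0 f1 af fD; elim: n x => [|n IH] x /=.
  by case: ifPn => [/set_mem /fD|_]; rewrite ?mule1// mule0 adde0.
case: ifPn => [/set_mem /fD|_]; first by rewrite mule1.
apply: (@le_trans _ _ (avg f x + c%:E * avg (hit D n) x)).
  exact: leeD2r.
rewrite -avgZ//; [|exact: measurable_hit|exact: hit_ge0].
have mh : measurable_fun setT (fun y : B => c%:E * hit D n y).
  by apply: measurable_funeM; exact: measurable_hit.
have h0 y : 0 <= c%:E * hit D n y by rewrite mule_ge0// hit_ge0.
rewrite -avgD// -[leRHS](avg_cst 1 x); apply: le_avg => //.
- exact: emeasurable_funD.
- by move=> y; rewrite adde_ge0.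
Qed.

Definition hits (D : set G) (x : B) : \bar R := limn (fun n => hit D n x).

Lemma hit_ndseq D x : open D -> nondecreasing_seq (fun n => hit D n x).
Proof. by move=> oD; apply/nondecreasing_seqP => n; exact: hit_nd. Qed.

Lemma cvg_hits D x : open D -> hit D n x @[n --> \oo] --> hits D x.
Proof.
by move=> oD; apply: (ereal_nondecreasing_is_cvgn (hit_ndseq x oD)).
Qed.

Lemma hit_hits D n x : open D -> hit D n x <= hits D x.
Proof.
move=> oD; rewrite /hits.
have /cvg_lim -> // := ereal_nondecreasing_cvgn (hit_ndseq x oD).
by apply: ereal_sup_ubound; exists n.
Qed.

Lemma hits_le D x y : open D -> (forall n, hit D n x <= y) -> hits D x <= y.
Proof.
move=> oD h; apply: lime_le; first exact: (ereal_nondecreasing_is_cvgn (hit_ndseq x oD)).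
exact: nearW.
Qed.

Lemma hits_ge0 D x : open D -> 0 <= hits D x.
Proof. by move=> oD; apply: le_trans (hit_hits 0 x oD); exact: hit_ge0. Qed.

Lemma hits_le1 D x : open D -> hits D x <= 1.
Proof. by move=> oD; apply: hits_le => // n; exact: hit_le1. Qed.

Lemma measurable_hits D : open D -> measurable_fun setT (hits D).
Proof.
move=> oD; apply: (emeasurable_fun_cvg (hit D)) => [n|x _].
  exact: measurable_hit.
exact: cvg_hits.
Qed.

Lemma hits_mulr D x g : hits D (x * g)%g = hits (rtrans D g) x.
Proof. by congr (limn _); apply/funext => n; rewrite hit_mulr. Qed.

Lemma hits1 D x : open D -> D x -> hits D x = 1.
Proof.
move=> oD Dx; apply/eqP; rewrite eq_le hits_le1//=.
by apply: le_trans (hit_hits 0 x oD) => /=; rewrite mem_set.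
Qed.

(** First step decomposition, in the limit of an infinite horizon. *)
Lemma hits_avg D x : open D -> ~ D x -> hits D x = avg (hits D) x.
Proof.
move=> oD Dx; apply/eqP; rewrite eq_le; apply/andP; split.
  apply: hits_le => // -[|n] /=; rewrite memNset//.
    by apply: avg_ge0 => y; exact: hits_ge0.
  apply: le_avg => //; [exact: measurable_hit|exact: measurable_hits|
    exact: hit_ge0|by move=> y; exact: hit_hits].
rewrite {1}/avg /hits monotone_convergence//.
- apply: lime_le.
    apply: ereal_nondecreasing_is_cvgn => m n mn.
    apply: ge0_le_integral => //.
    + by move=> z _; exact: hit_ge0.
    + by apply: measurable_mulr; exact: measurable_hit.
    + by apply: measurable_mulr; exact: measurable_hit.
    + by move=> z _; exact: hit_ndseq.
  apply: nearW => n.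
  by apply: le_trans (hit_hits n.+1 x oD) => /=; rewrite memNset.
- by move=> n; apply: measurable_mulr; exact: measurable_hit.
- by move=> n z _; exact: hit_ge0.
- by move=> z _; exact: hit_ndseq.
Qed.

Lemma le_hits D E x : open D -> open E -> D `<=` E -> hits D x <= hits E x.
Proof.
move=> oD oE DE; apply: hits_le => // n; apply: le_trans (hit_hits n x oE).
exact: le_hit.
Qed.

Lemma measurable_fun_rtrans (m : {sigma_finite_measure set B -> \bar R}) (A : set G) :
  open A -> measurable_fun [set: B] (fun x : B => m (rtrans A x)).
Proof.
move=> oA; pose O : set (G * G) := [set z | A (z.2 * z.1)%g].
have mO : measurable (O : set (B * B)%type).
  apply: open_borel_prod => //; apply: open_comp => // x _.
  by apply: continuousMg => y; [exact: cvg_snd|exact: cvg_fst].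
have := measurable_fun_xsection m mO.
congr (measurable_fun _ _); apply/funext => x /=; congr (m _).
by apply/seteqP; split => y /=; rewrite /xsection /= inE.
Qed.

End hitting.

(** * A recurrent walk visits every open set *)

Section recurrence.
Context (R : realType) (G : topGroupType) (lcscG : lcsc G).
Local Notation B := (borel G).
Local Open Scope ereal_scope.
Variables (mu : probability B R) (nu : nat -> probability B R).
Hypothesis nu0 : forall A : set G, open A -> nu 0 A = \d_(1%g : B) A.
Hypothesis nuS : forall k (A : set G), open A ->
  nu k.+1 A = \int[mu]_z nu k (rtrans A z).
Hypothesis nuoo : forall V : set G, open V -> V 1%g -> \sum_(k <oo) nu k V = +oo.
Hypothesis adp : adapted mu.

Let hits_ := hits mu.

Lemma avg_nu k (A : set G) x : open A ->
  avg mu (fun y => nu k (rtrans A y)) x = nu k.+1 (rtrans A x).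
Proof.
move=> oA; rewrite nuS; last exact: open_rtrans.
by apply: eq_integral => z _; rewrite rtransM.
Qed.

Let pot n (V : set G) (x : B) : \bar R := \sum_(k < n) nu k (rtrans V x).

Let pot_ge0 n V x : 0 <= pot n V x.
Proof. by apply: sume_ge0 => k _. Qed.

Let mpot n V : open V -> measurable_fun setT (pot n V).
Proof.
move=> oV; apply: emeasurable_sum => k; exact: measurable_fun_rtrans.
Qed.

Let potS n V x : open V -> pot n.+1 V x = \d_(1%g : B) (rtrans V x) + avg mu (pot n V) x.
Proof.
move=> oV; rewrite /pot big_ord_recl nu0; last exact: open_rtrans.
congr (_ + _); rewrite /avg ge0_integral_sum//.
  by apply: eq_bigr => k _; rewrite -avg_nu.
move=> k; apply: (@measurable_mulr _ _ (fun y : B => nu k (rtrans V y))).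
exact: measurable_fun_rtrans.
Qed.

Lemma avg_hits_le1 D x : open D -> avg mu (hits_ D) x <= 1.
Proof.
move=> oD; rewrite -[leRHS](avg_cst mu 1 x); apply: le_avg => //.
- exact: measurable_hits.
- by move=> y; exact: hits_ge0.
- by move=> y; exact: hits_le1.
Qed.

Lemma avg_hits_mulr D x : avg mu (hits_ D) x = avg mu (hits_ (rtrans D x)) 1%g.
Proof.
rewrite -[x in LHS]mul1g avgMr; congr (avg mu _ _); apply/funext => y.
exact: hits_mulr.
Qed.

Lemma avg_hits_le D x : open D -> avg mu (hits_ D) x <= hits_ D x.
Proof.
move=> oD; have [Dx|Dx] := pselect (D x); last by rewrite /hits_ -hits_avg.
by rewrite {2}/hits_ hits1//; exact: avg_hits_le1.
Qed.

Lemma le_avg_hits D E x : open D -> open E -> D `<=` E ->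
  avg mu (hits_ D) x <= avg mu (hits_ E) x.
Proof.
move=> oD oE DE; apply: le_avg => //.
- exact: measurable_hits.
- exact: measurable_hits.
- by move=> y; exact: hits_ge0.
- by move=> y; exact: le_hits.
Qed.

(** If a return to W from 1 failed with probability 1 - r > 0, then for a small
neighbourhood V each visit to V would be the last one with at least this
probability; summing over the time of the last visit, 1 - r times the expected
number of visits to V would be at most 1. *)
Lemma return_sure W : open W -> W 1%g -> avg mu (hits_ W) 1%g = 1.
Proof.
move=> oW W1; apply/eqP; rewrite eq_le avg_hits_le1//=.
rewrite leNgt; apply/negP => lt1.
have r0 : 0 <= avg mu (hits_ W) 1%g by apply: avg_ge0 => y; exact: hits_ge0.
have : avg mu (hits_ W) 1%g \is a fin_num.
  by rewrite ge0_fin_numE// (lt_trans lt1)// ltry.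
move: lt1 r0; set r' := avg _ _ _ => lt1 r0 /fineK rE.
move: lt1 r0; rewrite -rE; set r := fine r' => lt1 r0.
rewrite lte_fin in lt1; rewrite lee_fin in r0.
have /setpow_nbhs-/(_ 2%N)[V [oV V1 Vi VW]] : nbhs (1%g : G) W by exact: open_nbhs_nbhs.
have d0 : (0 < 1 - r)%R by lra.
have claim n x : (1 - r)%:E * pot n V x <= hits_ V x.
  elim: n x => [|n IH] x; first by rewrite /pot big_ord0 mule0; exact: hits_ge0.
  rewrite potS//.
  have le1 : avg mu (fun y => (1 - r)%:E * pot n V y) x <= avg mu (hits_ V) x.
    apply: le_avg => //.
    - by apply: measurable_funeM; exact: mpot.
    - exact: measurable_hits.
    - by move=> y; rewrite mule_ge0// lee_fin ltW.
  rewrite ge0_muleDr//; last by apply: avg_ge0.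
  rewrite -avgZ//; [|exact: mpot|exact: ltW].
  have [Vx|Vx] := pselect (V x); last first.
    rewrite diracE memNset/= ?mule0 ?add0e; last by rewrite /rtrans /= mul1g.
    by rewrite /hits_ hits_avg.
  rewrite diracE mem_set/= ?mule1; last by rewrite /rtrans /= mul1g.
  rewrite {1}/hits_ hits1// (_ : 1 = (1 - r)%:E + r%:E)//; last by rewrite -EFinD subrK.
  rewrite leeD2l//; apply: (le_trans le1).
  rewrite avg_hits_mulr rE; apply: le_avg_hits => //; first exact: open_rtrans.
  move=> y Vyx; apply: VW; rewrite -[y](mulgK x).
  by apply: (@setpowM _ _ 1 1); apply: setpow1 => //; exact: Vi.
have : \sum_(k <oo) nu k V <= ((1 - r)^-1)%:E.
  apply: lime_le; first exact: is_cvg_nneseries.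
  apply: nearW => n; rewrite big_mkord.
  have := claim n 1%g; rewrite /pot rtrans1 => cl.
  have : (1 - r)%:E * \sum_(k < n) nu k V <= 1.
    by apply: le_trans cl _; exact: hits_le1.
  by rewrite -lee_pdivlMl// mule1.
by rewrite nuoo// leye_eq.
Qed.

(** Away from W this is the first step decomposition; at a point x of W,
both sides equal 1 since W x^-1 is again a neighbourhood of 1. *)
Lemma hits_harmonic W x : open W -> W 1%g -> hits_ W x = avg mu (hits_ W) x.
Proof.
move=> oW W1; have [Wx|Wx] := pselect (W x); last exact: hits_avg.
rewrite {1}/hits_ hits1// avg_hits_mulr return_sure//; first exact: open_rtrans.
by rewrite /rtrans /= mul1g.
Qed.

(** Starting from 1, a visit near g has positive probability, and the walk
returns almost surely to a neighbourhood W of 1. If the way from g back to W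
failed with positive probability, the harmonic function [hits W] would be less
than 1 near g, hence at 1. *)
Lemma hits_inverse g : (forall E, open E -> E g -> 0 < hits_ E 1%g) ->
  forall D, open D -> D g^-1%g -> hits_ D 1%g = 1.
Proof.
move=> Tg D oD Dg; apply/eqP; rewrite eq_le hits_le1//= leNgt; apply/negP => lt1.
have r0 : 0 <= hits_ D 1%g by exact: hits_ge0.
have : hits_ D 1%g \is a fin_num.
  by rewrite ge0_fin_numE// (lt_trans lt1)// ltry.
move: lt1 r0; set r' := hits_ D _ => lt1 r0 /fineK rE.
move: lt1 r0; rewrite -rE; set r := fine r' => lt1 r0.
rewrite lte_fin in lt1; rewrite lee_fin in r0.
have : nbhs (1 * g^-1)%g D by rewrite mul1g; exact: open_nbhs_nbhs.
move=> /nbhs_mulg[W [C [[oW W1] [oC Cg] WC]]].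
pose E := [set x : G | C x^-1%g].
have oE : open E by exact: open_invs.
have := Tg E oE Cg; apply/negP; rewrite -leNgt.
apply: hits_le => // n.
have := @max_principle _ _ lcscG mu (hits_ W) (1 - r) E n 1%g oE.
have d0 : (0 < 1 - r)%R by lra.
have -> : hits_ W 1%g = 1 by exact: hits1.
move=> H.
have : 1 + (1 - r)%:E * hit mu E n 1%g <= 1.
  apply: H => //.
  - exact: measurable_hits.
  - by move=> y; exact: hits_ge0.
  - exact: ltW.
  - by move=> y; exact: hits_le1.
  - by move=> y; rewrite -hits_harmonic.
  - move=> y Ey; rewrite (_ : 1 = r%:E + (1 - r)%:E); last by rewrite -EFinD addrC subrK.
    rewrite leeD2r// rE -[y]mul1g /hits_ hits_mulr; apply: le_hits => //.
      exact: open_rtrans.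
    by move=> z Wzy; rewrite -[z](mulgK y); exact: WC.
rewrite -[leRHS]adde0 leeD2lE// pmule_rle0 ?lte_fin//.
Qed.

(** The points whose neighbourhoods are almost surely visited form a closed
subgroup: by [hits_inverse], stability under inverses even holds from points
whose neighbourhoods are visited with positive probability, such as those of
the support of [mu]. *)
Lemma hits_sure D : open D -> D !=set0 -> hits_ D 1%g = 1.
Proof.
pose S : set G := [set g | forall D, open D -> D g -> hits_ D 1%g = 1].
have SV g : S g -> S g^-1%g.
  move=> Sg; apply: hits_inverse => E oE Eg; rewrite Sg//.
have clS : closed S.
  rewrite closure_id; apply/seteqP; split; first exact: subset_closure.
  move=> g Sg E oE Eg; have [h [Sh Eh]] := Sg E (open_nbhs_nbhs (conj oE Eg)).
  exact: Sh.
have SM g h : S g -> S h -> S (g * h)%g.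
  move=> Sg Sh E oE Egh.
  have : nbhs (g * h)%g E by exact: open_nbhs_nbhs.
  move=> /nbhs_mulg[A [C [[oA Ag] [oC Ch] AC]]].
  apply/eqP; rewrite eq_le hits_le1//= -(Sh _ oC Ch); apply: hits_le => // n.
  have := @min_principle _ _ lcscG mu (hits_ E) 1 1 C n 1%g oC.
  rewrite expr1n mul1r !mul1e; apply.
  - exact: measurable_hits.
  - by move=> y; exact: hits_ge0.
  - by rewrite ler01 lexx.
  - exact: ler01.
  - by move=> y; rewrite mul1e; exact: avg_hits_le.
  - move=> y Cy; rewrite -[y]mul1g /hits_ hits_mulr -(Sg _ oA Ag); apply: le_hits => //.
      exact: open_rtrans.
    by move=> z Az; exact: AC.
have sgS : subgroup S.
  split; first by apply/mem_set => E oE E1; exact: hits1.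
  by move=> u v /set_mem Su /set_mem Sv; apply/mem_set; apply: SM => //; exact: SV.
have suppS : Defs.support mu `<=` S.
  move=> g sg; rewrite -[g]invgK; apply: SV; apply: hits_inverse => E oE Eg.
  have [E1|E1] := pselect (E 1%g); first by rewrite /hits_ hits1.
  rewrite /hits_ hits_avg//; apply: (@lt_le_trans _ _ (mu E)); first exact: sg.
  have mE : measurable (E : set B) by exact: open_borel.
  have -> : mu E = \int[mu]_z (\1_E z)%:E by rewrite integral_indic// setIT.
  apply: ge0_le_integral => //.
  - exact/measurable_EFinP.
  - apply: (@measurable_mulr _ _ (hits mu E)); exact: measurable_hits.
  - move=> z _; rewrite mulg1; have [Ez|Ez] := pselect (E z).
      by rewrite indicE mem_set// hits1.
    by rewrite indicE memNset//; exact: hits_ge0.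
move=> oD [g Dg]; suff : S g by apply.
have : smallest [set H | closed H /\ subgroup H] (Defs.support mu) `<=` S.
  by apply: smallest_sub.
by rewrite adp; apply.
Qed.

End recurrence.

(** * Discounted potentials *)

Section discounted.
Context (R : realType) (G : topGroupType) (lcscG : lcsc G).
Local Notation B := (borel G).
Local Open Scope ereal_scope.

Let scG : @second_countable G. Proof. by case: lcscG. Qed.

(** Viewed as a measure in A, this has total mass 1 / (1 - a). *)
Definition potential (nu : nat -> probability B R) (a : R) (A : set B) : \bar R :=
  \sum_(n <oo) (a ^+ n)%:E * nu n A.

Lemma potential_ge0 nu a A : (0 <= a)%R -> 0 <= potential nu a A.
Proof.
by move=> a0; apply: nneseries_ge0 => n _ _; rewrite mule_ge0// lee_fin exprn_ge0.
Qed.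

(** The properties of the convolution powers [nu] of an adapted recurrent law
[mu] from which its potential theory is derived. *)
Definition recurrent_powers (mu : probability B R) (nu : nat -> probability B R) :=
  [/\ forall A : set G, open A -> nu 0%N A = \d_(1%g : B) A,
      forall k (A : set G), open A -> nu k.+1 A = \int[mu]_z nu k (rtrans A z),
      forall V : set G, open V -> V 1%g -> \sum_(k <oo) nu k V = +oo &
      adapted mu].

(** With [tr] one of the two translations: up to a factor 2, the potential of
[A] dominates every lower bound for the potentials of the translates of [A] by
elements of [Z]. *)
Definition reach_below (nu : nat -> probability B R) (a : R)
    (tr : set G -> G -> set G) (Z : set G) :=
  forall (A : set G) (c : R), open A -> (0 <= c)%R ->
    (forall z, Z z -> c%:E <= potential nu a (tr A z)) ->
    (c / 2)%:E <= potential nu a A.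

Variables (mu : probability B R) (nu : nat -> probability B R).
Hypothesis rs : recurrent_powers mu nu.

Lemma measurable_potential a (A : set G) : (0 <= a)%R -> open A ->
  measurable_fun setT (fun x : B => potential nu a (rtrans A x)).
Proof.
move=> a0 oA; apply: ge0_emeasurable_sum => [k x _ _|k _].
  by rewrite mule_ge0// lee_fin exprn_ge0.
by apply: measurable_funeM; exact: measurable_fun_rtrans.
Qed.

(** Dropping the term of index 0 in the series shifts it by one step of the walk. *)
Lemma potential_superharmonic a (A : set G) x : (0 <= a)%R -> open A ->
  a%:E * avg mu (fun x => potential nu a (rtrans A x)) x <= potential nu a (rtrans A x).
Proof.
move=> a0 oA; have [nu0 nuS _ _] := rs.
rewrite {2}/potential nneseries_recl//; last first.
  by move=> k _; rewrite mule_ge0// lee_fin exprn_ge0.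
apply: (@le_trans _ _ (\sum_(1 <= k <oo) (a ^+ k)%:E * nu k (rtrans A x))); last first.
  by rewrite leeDr// expr0 mul1e.
rewrite -(@nneseries_addn _ _ 1%N); last first.
  by move=> k; rewrite mule_ge0// lee_fin exprn_ge0.
rewrite /avg /potential integral_nneseries//; last 2 first.
- move=> n; apply: (@measurable_mulr _ _ (fun y : B => (a ^+ n)%:E * nu n (rtrans A y))).
  by apply: measurable_funeM; exact: measurable_fun_rtrans.
- by move=> n y _; rewrite mule_ge0// lee_fin exprn_ge0.
rewrite -nneseriesZl; last first.
  by move=> n _; apply: integral_ge0 => y _; rewrite mule_ge0// lee_fin exprn_ge0.
rewrite le_eqVlt; apply/orP; left; apply/eqP; apply: eq_eseriesr => n _.
have mn := measurable_fun_rtrans lcscG (nu n) oA.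
have := @avgZ _ _ mu (fun y => nu n (rtrans A y)) (a ^+ n) x mn.
rewrite /avg => ->//; last by rewrite exprn_ge0.
rewrite addn1 exprS EFinM -muleA; congr (_ * (_ * _)).
exact: (@avg_nu _ _ mu nu nuS n A x oA).
Qed.

(** The walk visits D with probability at least 3/4 within some number n of
steps, and the discount a^n is at least 2/3 when a is close to 1. *)
Lemma reach_r (D : set G) : open D -> D !=set0 ->
  \forall a \near (1%R : R)^'-, reach_below nu a (@rtrans G) D.
Proof.
move=> oD D0; have [nu0 nuS nuoo adp] := rs.
have lt34 : (3 / 4 < 1 :> R)%R by lra.
have h1 := hits_sure lcscG nu0 nuS nuoo adp oD D0.
have [n hn] : exists n, (3/4)%:E <= hit mu D n 1%g.
  apply: contrapT => nex; have : hits mu D 1%g <= (3/4)%:E.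
    apply: hits_le => // n; rewrite leNgt; apply/negP => lt; apply: nex.
    by exists n; exact: ltW.
  by rewrite h1 lee_fin leNgt lt34.
clear h1.
have : (fun a : R => a ^+ n)%R @ 1%R^'- --> (1%R : R).
  apply: cvg_at_left_filter; rewrite -[X in _ --> X](expr1n R n).
  exact: exprn_continuous.
have e3 : (0 < 1 / 3 :> R)%R by lra.
move=> /cvgrPdist_lt/(_ _ e3) near_n.
near=> a; move=> A c oA c0 cD.
have a01 : (0 <= a <= 1)%R.
  apply/andP; split; last by near: a; exact: nbhs_left_le.
  by near: a; apply: nbhs_left_ge; lra.
have an : (2 / 3 <= a ^+ n)%R.
  have : (`|1 - a ^+ n| < 1 / 3)%R by near: a.
  rewrite ltr_distlC => /andP[+ _]; lra.
have a0 : (0 <= a)%R by case/andP: a01.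
have := @min_principle _ _ lcscG mu (fun x => potential nu a (rtrans A x)) a c D n 1%g oD.
rewrite rtrans1 => /(_ (measurable_potential a0 oA)) H.
apply: (@le_trans _ _ ((a ^+ n * c)%:E * hit mu D n 1%g)); last first.
  apply: H => // y; [exact: potential_ge0|exact: potential_superharmonic].
apply: (@le_trans _ _ ((a ^+ n * c)%:E * (3/4)%:E)).
  rewrite -EFinM lee_fin; have := ler_wpM2r c0 an; lra.
by rewrite lee_wpmul2l// lee_fin mulr_ge0// exprn_ge0.
Unshelve. all: end_near. Qed.

(** Here the target is the fibre of O over a point of a compact set K. Near a
point of K all fibres contain a common open set, so finitely many targets
suffice and a can be chosen uniformly in K. *)
Lemma reach_r_unif (K : set G) (O : set (G * G)) : compact K -> open O ->
  (forall y, K y -> exists z, O (y, z)) ->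
  \forall a \near (1%R : R)^'-, forall y, K y ->
    reach_below nu a (@rtrans G) [set z | O (y, z)].
Proof.
move=> cK oO Oz.
have /compact_near_coveringP ncK := cK.
have := ncK R (1%R : R)^'- (fun a y =>
  reach_below nu a (@rtrans G) [set z | O (y, z)]) _.
apply => y Ky; have [z Oyz] := Oz y Ky.
have [[V D] [/= nV nD] VD] : nbhs (y, z) O by exact: open_nbhs_nbhs.
move: nD; rewrite nbhsE => -[D' [oD' D'z] D'D].
have near_a := reach_r oD' (ex_intro _ z D'z).
exists (V, [set a | reach_below nu a (@rtrans G) D']).
  by split.
move=> [y' a] [/= Vy' Ha] A c oA c0 H; apply: Ha => // w D'w.
by apply: H; apply: (VD (y', w)); split => //=; exact: D'D.
Qed.

End discounted.

(** Inversion exchanges left and right translations, and the inverse of a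
recurrent walk has the same return probabilities. *)
Section inverse.
Context (R : realType) (G : topGroupType) (lcscG : lcsc G).
Local Notation B := (borel G).
Local Open Scope ereal_scope.

Definition invb (x : B) : B := (x : G)^-1%g.

Lemma measurable_invb : measurable_fun setT invb.
Proof. by apply: (@continuous_borel G G); exact: invg_continuous. Qed.

HB.instance Definition _ := isMeasurableFun.Build _ _ B B invb measurable_invb.

Definition prob_inv (m : probability B R) : probability B R :=
  distribution m [the {mfun B >-> B} of invb].

Lemma prob_invE (m : probability B R) A : prob_inv m A = m (invs A).
Proof. by []. Qed.

Lemma recurrent_powers_inv (mu : probability B R) (nu : nat -> probability B R) :
  recurrent_powers mu nu ->
  (forall k (A : set G), open A -> nu k.+1 A = \int[mu]_z nu k (ltrans A z)) ->
  recurrent_powers (prob_inv mu) (prob_inv \o nu).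
Proof.
move=> [nu0 nuS nuoo adp] nuS'; split.
- move=> A oA; rewrite /= prob_invE nu0; last exact: open_invs.
  by rewrite !diracE /invs; congr (_%:E); congr (nat_of_bool _)%:R;
    apply/idP/idP => /set_mem; rewrite /= ?invg1 => H; apply/mem_set; rewrite /= ?invg1.
- move=> k A oA; rewrite /= prob_invE nuS'; last exact: open_invs.
  rewrite ge0_integral_pushforward//; last first.
    exact: (@measurable_fun_rtrans _ _ lcscG (prob_inv (nu k))).
  apply: eq_integral => z _ /=; rewrite prob_invE; congr (nu k _).
  by apply/seteqP; split => y; rewrite /ltrans /rtrans /invs /= invgM.
- move=> V oV V1; rewrite -[RHS](nuoo (invs V)); last 2 first.
  + exact: open_invs.
  + by rewrite /invs /= invg1.
  by [].
- apply/seteqP; split => // g _; move=> H [[clH sgH] sH].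
  suff HT : [set: G] `<=` H by exact: (HT g I).
  rewrite -adp; apply: smallest_sub => // x sx.
  rewrite -[x]invgK; apply/set_mem; apply: (group_closedV sgH).
  apply/mem_set; apply: sH => U [oU Ux]; rewrite prob_invE; apply: sx.
  by split; [exact: open_invs|].
Qed.

(** [reach_r_unif] for the inverse walk. *)
Lemma reach_l_unif (mu : probability B R) (nu : nat -> probability B R)
    (K : set G) (O : set (G * G)) :
  recurrent_powers mu nu ->
  (forall k (A : set G), open A -> nu k.+1 A = \int[mu]_z nu k (ltrans A z)) ->
  compact K -> open O ->
  (forall y, K y -> exists z, O (y, z)) ->
  \forall a \near (1%R : R)^'-, forall y, K y ->
    reach_below nu a (@ltrans G) [set z | O (y, z)].
Proof.
move=> rs nuS' cK oO Oz.
have rs' := recurrent_powers_inv rs nuS'.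
pose O' : set (G * G) := [set p | O (p.1, p.2^-1%g)].
have oO' : open O'.
  apply: open_comp => // p _.
  by apply: cvg_pair => /=; [exact: cvg_fst|apply: cvgVg; exact: cvg_snd].
have Oz' y : K y -> exists z, O' (y, z).
  by move=> /Oz[z Oyz]; exists z^-1%g; rewrite /O' /= invgK.
have := reach_r_unif lcscG rs' cK oO' Oz'.
apply: filterS => a H y Ky A c oA c0 cz.
have potE (E : set G) : potential (prob_inv \o nu) a E = potential nu a (invs E) by [].
rewrite -[A]invsK -potE; apply: (H y Ky) => //; first exact: open_invs.
move=> z Oyz; rewrite potE (_ : invs _ = ltrans A z^-1%g).
  exact: cz.
by apply/seteqP; split => x; rewrite /invs /ltrans /rtrans /= invgM invgK.
Qed.

End inverse.

(** * The Harnack inequality *)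

(** A copy of the measure, on which finiteness can be declared as an instance. *)
Definition finite_copy d (T : measurableType d) (R : realType)
  (m : {measure set T -> \bar R}) of fin_num_fun m : set T -> \bar R := m.

Section finite_copy.
Context d (T : measurableType d) (R : realType) (m : {measure set T -> \bar R}).
Hypothesis mfin : fin_num_fun m.

HB.instance Definition _ := Measure.copy (finite_copy mfin) m.
HB.instance Definition _ := Measure_isFinite.Build _ _ _ (finite_copy mfin) mfin.

End finite_copy.

Lemma finite_measure_ex d (T : measurableType d) (R : realType)
  (m : {measure set T -> \bar R}) : (m setT < +oo)%E ->
  exists m' : {finite_measure set T -> \bar R}, forall A, m' A = m A.
Proof.
move=> mT.
have fin : fin_num_fun m.
  move=> A mA; rewrite ge0_fin_numE//; apply: le_lt_trans mT.
  by apply: le_measure => //; rewrite inE.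
by exists (finite_copy fin).
Qed.

Section fubini_open.
Context (R : realType) (S T : ptopologicalType).
Hypothesis (scS : @second_countable S) (scT : @second_countable T).
Local Open Scope ereal_scope.

Variables (m1 : {sigma_finite_measure set (borel S) -> \bar R})
  (m2 : {sigma_finite_measure set (borel T) -> \bar R}).

Lemma measurable_section1 (O : set (S * T)) : open O ->
  measurable_fun [set: borel S] (fun x : borel S => m2 [set y | O (x, y)]).
Proof.
move=> oO; have mO := open_borel_prod scS scT oO.
have := measurable_fun_xsection m2 mO.
congr (measurable_fun _ _); apply/funext => x /=; congr (m2 _).
by apply/seteqP; split => y /=; rewrite /xsection /= inE.
Qed.

Lemma fubini_open (O : set (S * T)) : open O ->
  \int[m1]_x m2 [set y | O (x, y)] = \int[m2]_y m1 [set x | O (x, y)].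
Proof.
move=> oO; have mO := open_borel_prod scS scT oO.
have := indic_fubini_tonelli m1 m2 mO.
rewrite indic_fubini_tonelli_FE// indic_fubini_tonelli_GE//.
under eq_integral => x _.
  rewrite /= (_ : xsection _ _ = [set y | O (x, y)]); last first.
    by apply/seteqP; split => y /=; rewrite /xsection /= inE.
  over.
move=> ->; apply: eq_integral => y _ /=; congr (m1 _).
by apply/seteqP; split => x /=; rewrite /ysection /= inE.
Qed.

End fubini_open.

Section harnack.
Context (R : realType) (G : topGroupType) (lcscG : lcsc G).
Local Notation B := (borel G).
Local Open Scope ereal_scope.

Let scG : @second_countable G. Proof. by case: lcscG. Qed.

Variables (mu : probability B R) (nu : nat -> probability B R).
Hypothesis rs : recurrent_powers mu nu.
Hypothesis nuS' :
  forall k (A : set G), open A -> nu k.+1 A = \int[mu]_z nu k (ltrans A z).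

Lemma potential_setT (a : R) : (0 < a < 1)%R -> potential nu a setT < +oo.
Proof.
move=> /andP[a0 a1].
have -> : potential nu a setT = \sum_(n <oo) (geometric 1 a n)%:E.
  apply: eq_eseriesr => n _; rewrite /= mul1r -[RHS]mule1; congr (_ * _).
  exact: probability_setT.
apply: (@le_lt_trans _ _ (1 / (1 - a))%:E); last exact: ltry.
apply: lime_le.
  apply: is_cvg_nneseries => n _ _.
  by rewrite lee_fin /= mul1r exprn_ge0// ltW.
apply: nearW => n; rewrite sumEFin lee_fin.
have := @geometric_le_lim R n 1 a ler01 a0.
by apply; rewrite ger0_norm// ltW.
Qed.

Lemma potential_measure (a : R) : (0 < a < 1)%R ->
  exists s : {finite_measure set B -> \bar R}, forall A, s A = potential nu a A.
Proof.
move=> a01; have /andP[a0 a1] := a01.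
pose an n : {nonneg R} := NngNum (exprn_ge0 n (ltW a0)).
pose m : {measure set B -> \bar R} := mseries (fun n => mscale (an n) (nu n)) 0.
have [|s sE] := @finite_measure_ex _ B R m; first exact: potential_setT.
by exists s.
Qed.

Lemma potential_translate (a : R) (x : G) : (0 < a < 1)%R ->
  exists s : {finite_measure set B -> \bar R},
    forall A, s A = potential nu a (rtrans A x).
Proof.
move=> a01; have [s sE] := potential_measure a01.
pose f : B -> B := fun y => ((y : G) * x)%g.
have mf : measurable_fun setT f.
  by apply: (@continuous_borel G G); exact: continuous_mulr.
pose m : {measure set B -> \bar R} := pushforward s f.
have mE A : m mf A = potential nu a (rtrans A x) by exact: sE.
have [|s' s'E] := @finite_measure_ex _ B R (m mf).
  by rewrite mE; exact: potential_setT.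
by exists s' => A; rewrite s'E mE.
Qed.

Lemma potential_ge1 (a : R) (A : set G) : (0 < a)%R -> open A -> A 1%g ->
  1 <= potential nu a A.
Proof.
move=> a0 oA A1; have [nu0 _ _ _] := rs.
apply: (@le_trans _ _ (\sum_(0 <= n < 1) (a ^+ n)%:E * nu n A)); last first.
  apply: nneseries_lim_ge.
  by move=> n _ _; rewrite mule_ge0// lee_fin exprn_ge0// ltW.
rewrite big_nat1 expr0 mul1e nu0// diracE mem_set//.
Qed.

Variables (W K0 : set G).
Hypothesis (oW : open W) (W1 : W 1%g) (Wi : forall w, W w -> W w^-1%g).
Hypothesis (cK0 : compact K0) (WK0 : setpow W 4 `<=` K0).

Let oWn n : open (setpow W n.+1). Proof. exact: setpow_open. Qed.

Lemma finite_translate_cover : exists s : seq G,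
  {in s, forall g, K0 g} /\ (forall y, K0 y -> exists2 g, g \in s & W (g^-1 * y)%g).
Proof.
have := cK0; rewrite compact_cover.
move=> /(_ G K0 (fun g => ltrans W g^-1%g)) [].
- by move=> g _; exact: open_ltrans.
- by move=> y K0y; exists y => //; rewrite /ltrans /= mulVg.
- move=> D' D'K cov; exists (enum_fset D'); split.
    by move=> g gD; have /set_mem := D'K g gD.
  by move=> y /cov[g /= gD Wgy]; exists g.
Qed.

(** [reach_l_unif] as a comparison between two sets: A contains the translates
of E by the elements z of the target. *)
Lemma reach_l_sets (K : set G) (O : set (G * G)) : compact K -> open O ->
  (forall y, K y -> exists z, O (y, z)) ->
  \forall a \near (1%R : R)^'-, forall y, K y -> forall x (E A : set G),
    open A -> open E ->
    (forall z e, O (y, z) -> E e -> A (z * e)%g) ->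
    potential nu a (rtrans E x) <= 2%:E * potential nu a (rtrans A x).
Proof.
move=> cK oO Oz; near=> a; move=> y Ky x E A oA oE EA.
have a01 : (0 < a < 1)%R.
  apply/andP; split; last by near: a; exact: nbhs_left_lt.
  by near: a; exact: nbhs_left_gt.
have a0 : (0 <= a)%R by case/andP: a01 => /ltW.
have [s sE] := potential_translate x a01.
have fE : s E \is a fin_num by apply: fin_num_measure; exact: open_borel.
have : (fine (s E) / 2)%:E <= potential nu a (rtrans A x).
  have : forall y, K y -> reach_below nu a (@ltrans G) [set z | O (y, z)].
    by near: a; exact: (reach_l_unif lcscG rs nuS' cK oO Oz).
  move=> /(_ y Ky (rtrans A x) (fine (s E))); apply.
  - exact: open_rtrans.
  - exact: fine_ge0.
  - move=> z Oyz; rewrite fineK// sE.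
    have [s1 s1E] := potential_measure a01.
    rewrite -!s1E; apply: le_measure; rewrite ?inE.
    + by apply: open_borel; exact: open_rtrans.
    + by apply: open_borel; apply: open_ltrans; exact: open_rtrans.
    + by move=> u Eux; rewrite /ltrans /rtrans /= -mulgA; exact: EA.
rewrite EFinM fineK// -!sE => h.
by rewrite muleC -lee_pdivrMr.
Unshelve. all: end_near. Qed.

Lemma reach_r_sets (K : set G) (O : set (G * G)) : compact K -> open O ->
  (forall y, K y -> exists z, O (y, z)) ->
  \forall a \near (1%R : R)^'-, forall y, K y -> forall (E A : set G),
    open A -> open E ->
    (forall z e, O (y, z) -> E e -> A (e * z)%g) ->
    potential nu a E <= 2%:E * potential nu a A.
Proof.
move=> cK oO Oz; near=> a; move=> y Ky E A oA oE EA.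
have a01 : (0 < a < 1)%R.
  apply/andP; split; last by near: a; exact: nbhs_left_lt.
  by near: a; exact: nbhs_left_gt.
have a0 : (0 <= a)%R by case/andP: a01 => /ltW.
have [s sE] := potential_measure a01.
have fE : s E \is a fin_num by apply: fin_num_measure; exact: open_borel.
have : (fine (s E) / 2)%:E <= potential nu a A.
  have : forall y, K y -> reach_below nu a (@rtrans G) [set z | O (y, z)].
    by near: a; exact: (reach_r_unif lcscG rs cK oO Oz).
  move=> /(_ y Ky A (fine (s E))); apply => //.
  - exact: fine_ge0.
  - move=> z Oyz; rewrite fineK//.
    rewrite -!sE; apply: le_measure; rewrite ?inE.
    + exact: open_borel.
    + by apply: open_borel; exact: open_rtrans.
    + by move=> u Eu; exact: EA.
rewrite EFinM fineK// -!sE => h.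
by rewrite muleC -lee_pdivrMr.
Unshelve. all: end_near. Qed.

End harnack.

Lemma measure_cover d (T : measurableType d) (R : realType)
    (m : {measure set T -> \bar R}) (I : eqType) (s : seq I) (F : I -> set T) (A : set T) :
  (forall i, measurable (F i)) -> measurable A ->
  (forall x, A x -> exists2 i, i \in s & F i x) ->
  (m A <= \sum_(i <- s) m (F i))%E.
Proof.
move=> mF; elim: s A => [|i s IH] A mA AF.
  rewrite big_nil (_ : A = set0) ?measure0//.
  by apply/seteqP; split => // x /AF[].
rewrite big_cons; apply: (@le_trans _ _ (m (F i `|` (A `\` F i)))).
  apply: le_measure; rewrite ?inE//.
    by apply: measurableU => //; exact: measurableD.
  by move=> x Ax; have [Fx|Fx] := pselect (F i x); [left|right].
apply: (le_trans (measureU2 _ _ _)) => //; first exact: measurableD.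
rewrite leeD2l//; apply: IH; first exact: measurableD.
by move=> x [/AF[j]]; rewrite in_cons => /orP[/eqP ->//|js] Fj _; exists j.
Qed.

Section harnack.
Context (R : realType) (G : topGroupType) (lcscG : lcsc G).
Local Notation B := (borel G).
Local Open Scope ereal_scope.

Let scG : @second_countable G. Proof. by case: lcscG. Qed.

Variables (mu : probability B R) (nu : nat -> probability B R).
Hypothesis rs : recurrent_powers mu nu.
Hypothesis nuS' :
  forall k (A : set G), open A -> nu k.+1 A = \int[mu]_z nu k (ltrans A z).
Variables (W K0 : set G).
Hypothesis (oW : open W) (W1 : W 1%g) (Wi : forall w, W w -> W w^-1%g).
Hypothesis (cK0 : compact K0) (WK0 : setpow W 4 `<=` K0).

Let oWn n : open (setpow W n.+1). Proof. exact: setpow_open. Qed.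
Let powM m n x y : setpow W m x -> setpow W n y -> setpow W (m + n) (x * y)%g.
Proof. exact: setpowM. Qed.
Let pow1 x : W x -> setpow W 1 x. Proof. exact: setpow1. Qed.
Let powV n x : setpow W n x -> setpow W n x^-1%g. Proof. exact: setpowV. Qed.

(** W^4 is covered by N translates of W, and left reachability compares the
potential of each of them to that of W^2. *)
Lemma doubling : exists N : nat, \forall a \near (1%R : R)^'-, forall x,
  potential nu a (rtrans (setpow W 4) x) <= N%:R%:E * potential nu a (rtrans (setpow W 2) x).
Proof.
have [s [sK0 scov]] := finite_translate_cover oW W1 cK0.
exists (2 * size s)%N.
pose O : set (G * G) := [set p | W (p.2 * p.1)%g].
have oO : open O.
  apply: open_comp => // p _.
  by apply: continuousMg => q; [exact: cvg_snd|exact: cvg_fst].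
have Oz y : K0 y -> exists z, O (y, z).
  by move=> _; exists y^-1%g; rewrite /O /= mulVg.
near=> a; move=> x.
have a01 : (0 < a < 1)%R.
  apply/andP; split; last by near: a; exact: nbhs_left_lt.
  by near: a; exact: nbhs_left_gt.
have [m mE] := potential_translate nu x a01.
rewrite -!mE; apply: (@le_trans _ _ (\sum_(g <- s) m (ltrans W g^-1%g))).
  apply: measure_cover.
  - by move=> g; apply: open_borel; exact: open_ltrans.
  - exact: open_borel.
  - by move=> y /WK0/scov.
apply: (@le_trans _ _ (\sum_(g <- s) 2%:E * m (setpow W 2))); last first.
  rewrite big_const_seq count_predT iter_addr addr0 -[X in X <= _]mule_natl.
  by rewrite natrM EFinM -muleA muleCA.
rewrite big_seq [leRHS]big_seq; apply: lee_sum => g /sK0 K0g.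
rewrite !mE.
have H : forall y, K0 y -> forall x (E A : set G), open A -> open E ->
    (forall z e, O (y, z) -> E e -> A (z * e)%g) ->
    potential nu a (rtrans E x) <= 2%:E * potential nu a (rtrans A x).
  by near: a; exact: (reach_l_sets lcscG rs nuS' cK0 oO Oz).
apply: (H g K0g x (ltrans W g^-1%g)) => //; first exact: open_ltrans.
move=> z e Ozg We; rewrite -[e](mulVKg g) mulgA.
by apply: (@powM 1 1); exact: pow1.
Unshelve. all: end_near. Qed.

(** With s the potential and m the measure s (. x^-1), consider the pairs
(z, y) with z in W^2 h^-1 and y z in W^3. For fixed z in W^2 h^-1, right
reachability bounds s (W^2) by twice the s-mass of the fibre. For fixed
y, left reachability moves the fibre into the set of z in W^4 with
z in y W^3 h^-1. Integrating over y first, for fixed z in W^4 left reachability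
bounds the s-mass of the y in z h W^3 by 2 s (W^4). Hence
  m (W^2 h^-1) s (W^2) <= 8 m (W^4) s (W^4),
and [doubling] returns from W^4 to W^2. Only the compact sets in which z and y
vary, hence only a, depend on h. *)
Lemma potential_harnack : exists2 C : R, (0 < C)%R & forall h,
  \forall a \near (1%R : R)^'-, forall x,
  potential nu a (rtrans (setpow W 2) (x * h)%g) <= C%:E * potential nu a (rtrans (setpow W 2) x).
Proof.
have [N dbl] := doubling.
exists (8 * N%:R * N%:R + 1)%R => [|h].
  by rewrite ltr_wpDl// mulr_ge0// mulr_ge0.
(* the compact sets in which z and y range, and the three targets *)
pose K1 : set G := [set (k * h^-1)%g | k in K0].
have cK1 : compact K1.
  apply: continuous_compact => //; apply: continuous_subspaceT.
  exact: continuous_mulr.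
pose K2 : set G := [set (p.1 * (h * p.2))%g | p in K0 `*` K0].
have cK2 : compact K2.
  apply: continuous_compact; last exact: compact_setX.
  apply: continuous_subspaceT; apply: continuousMg => p; first exact: cvg_fst.
  by apply: cvgMg; [exact: cvg_cst|exact: cvg_snd].
pose O1 : set (G * G) := [set p | W (p.2 * p.1)%g].
have oO1 : open O1.
  apply: open_comp => // p _.
  by apply: continuousMg => q; [exact: cvg_snd|exact: cvg_fst].
pose O2 : set (G * G) := [set p | W (p.2 * p.1^-1)%g /\ W (p.1^-1 * p.2)%g].
have oO2 : open O2.
  apply: openI; apply: (@open_comp _ _ _ W) => // p _.
    by apply: cvgMg; [exact: cvg_snd|apply: cvgVg; exact: cvg_fst].
  by apply: cvgMg; [apply: cvgVg; exact: cvg_fst|exact: cvg_snd].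
pose O3 : set (G * G) := [set p | W (p.2 * (p.1 * h))%g].
have oO3 : open O3.
  apply: open_comp => // p _.
  apply: cvgMg; first exact: cvg_snd.
  by apply: cvgMg; [exact: cvg_fst|exact: cvg_cst].
near=> a.
have a01 : (0 < a < 1)%R.
  apply/andP; split; last by near: a; exact: nbhs_left_lt.
  by near: a; exact: nbhs_left_gt.
have H1 : forall y, K1 y -> forall (E A : set G), open A -> open E ->
    (forall z e, O1 (y, z) -> E e -> A (e * z)%g) ->
    potential nu a E <= 2%:E * potential nu a A.
  near: a; apply: (reach_r_sets lcscG rs cK1 oO1) => // y _.
  by exists y^-1%g; rewrite /O1 /= mulVg.
have H2 : forall y, K2 y -> forall x (E A : set G), open A -> open E ->
    (forall z e, O2 (y, z) -> E e -> A (z * e)%g) ->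
    potential nu a (rtrans E x) <= 2%:E * potential nu a (rtrans A x).
  near: a; apply: (reach_l_sets lcscG rs nuS' cK2 oO2) => // y _.
  by exists y; rewrite /O2 /= mulVg mulgV.
have H3 : forall y, K0 y -> forall x (E A : set G), open A -> open E ->
    (forall z e, O3 (y, z) -> E e -> A (z * e)%g) ->
    potential nu a (rtrans E x) <= 2%:E * potential nu a (rtrans A x).
  near: a; apply: (reach_l_sets lcscG rs nuS' cK0 oO3) => // y _.
  by exists (y * h)^-1%g; rewrite /O3 /= mulVg.
have D : forall x,
  potential nu a (rtrans (setpow W 4) x) <= N%:R%:E * potential nu a (rtrans (setpow W 2) x).
  by near: a.
move=> x.
have [s sE] := potential_measure nu a01.
have [m mE] := potential_translate nu x a01.
have mh : potential nu a (rtrans (setpow W 2) (x * h)%g) = m (rtrans (setpow W 2) h).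
  by rewrite mE rtransM.
rewrite mh -mE.
have oA : open (rtrans (setpow W 2) h) by exact: open_rtrans.
have s1 : 1 <= s (setpow W 2).
  rewrite sE; apply: (potential_ge1 rs); [by case/andP: a01|exact: oWn|].
  by apply: (@setpow_le _ _ 1); rewrite //; exact: pow1.
have finE (E : set G) (n : {finite_measure set B -> \bar R}) : open E ->
    n E \is a fin_num.
  by move=> oE; apply: fin_num_measure; exact: open_borel.
have mB (E : set G) : open E -> measurable (E : set B) by exact: open_borel.
(* the pairs (z, y) before and after the left translation of their fibres *)
pose P : set (G * G) := [set p | setpow W 2 (p.1 * h)%g /\ setpow W 3 (p.2 * p.1)%g].
have oP : open P.
  apply: openI.
    apply: (@open_comp _ _ _ (setpow W 2)) => // p _.
    by apply: cvgMg; [exact: cvg_fst|exact: cvg_cst].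
  apply: (@open_comp _ _ _ (setpow W 3)) => // p _.
  by apply: cvgMg; [exact: cvg_snd|exact: cvg_fst].
pose Q : set (G * G) := [set p | setpow W 4 p.1 /\ setpow W 3 (p.2^-1 * p.1 * h)%g].
have oQ : open Q.
  apply: openI.
    by apply: (@open_comp _ _ _ (setpow W 4)) => // p _; exact: cvg_fst.
  apply: (@open_comp _ _ _ (setpow W 3)) => // p _.
  apply: cvgMg; last exact: cvg_cst.
  by apply: cvgMg; [apply: cvgVg; exact: cvg_snd|exact: cvg_fst].
have step1 : m (rtrans (setpow W 2) h) * s (setpow W 2) <=
    2%:E * \int[m]_z s [set y | P (z, y)].
  have -> : m (rtrans (setpow W 2) h) * s (setpow W 2) =
     \int[m]_(z in rtrans (setpow W 2) h) cst (s (setpow W 2)) z.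
    by rewrite integral_cst; [exact: muleC|exact: mB].
  rewrite -ge0_integralZl//; last exact: measurable_section1.
  rewrite [leLHS]integral_mkcond; apply: ge0_le_integral => //.
  - by move=> z _; rewrite /patch; case: ifP.
  - by apply/(measurable_restrictT _ _).1; [exact: mB|exact: measurable_cst].
  - by apply: measurable_funeM; exact: measurable_section1.
  - move=> z _; rewrite /patch; case: ifPn => [/set_mem Az|_]; last first.
      by rewrite mule_ge0.
    rewrite (_ : [set y | P (z, y)] = rtrans (setpow W 3) z); last first.
      by apply/seteqP; split=> y; [case|move=> ?; split].
    rewrite /= !sE; apply: (H1 z) => //.
    + exists (z * h)%g; last by rewrite mulgK.
      by apply: WK0; apply: (@setpow_le _ _ 2).
    + exact: open_rtrans.
    + move=> w e Ww We; rewrite /rtrans /= -mulgA.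
      by apply: (@powM 2 1) => //; exact: pow1.
have step2 : \int[m]_z s [set y | P (z, y)] <= 2%:E * \int[m]_z s [set y | Q (z, y)].
  rewrite !(fubini_open _ _ _ _ _)// -ge0_integralZl//; last first.
    apply: (@measurable_section1 _ _ _ scG scG m [set p | Q (p.2, p.1)]).
    apply: (@open_comp _ _ (fun p : G * G => (p.2, p.1))) => // p _.
    by apply: cvg_pair; [exact: cvg_snd|exact: cvg_fst].
  apply: ge0_le_integral => //.
  - apply: (@measurable_section1 _ _ _ scG scG m [set p | P (p.2, p.1)]).
    apply: (@open_comp _ _ (fun p : G * G => (p.2, p.1))) => // p _.
    by apply: cvg_pair; [exact: cvg_snd|exact: cvg_fst].
  - apply: measurable_funeM.
    apply: (@measurable_section1 _ _ _ scG scG m [set p | Q (p.2, p.1)]).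
    apply: (@open_comp _ _ (fun p : G * G => (p.2, p.1))) => // p _.
    by apply: cvg_pair; [exact: cvg_snd|exact: cvg_fst].
  - move=> y _.
    have osec (O : set (G * G)) : open O -> open [set z | O (z, y)].
      move=> oO; apply: (@open_comp _ _ (fun z : G => (z, y))) => // z _.
      by apply: cvg_pair; [exact: cvg_id|exact: cvg_cst].
    have [[z [Wz Wyz]]|nz] := pselect (exists z, P (z, y)); last first.
      rewrite (_ : [set z | P (z, y)] = set0) ?measure0 ?mule_ge0//.
      by apply/seteqP; split => // z Pz; apply: nz; exists z.
    change (m [set z | P (z, y)] <= 2%:E * m [set z | Q (z, y)]).
    rewrite !mE; apply: (H2 y) => //; [|exact: osec|exact: osec|].
      exists ((y * z)%g, (z * h)^-1%g).
        split => /=; apply: WK0; first exact: (@setpow_le _ _ 3).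
        by apply: (@setpow_le _ _ 2) => //; exact: powV.
      by rewrite /= invgM mulVKg mulgK.
    move=> w e [/= Ww1 Ww2] [/= We1 We2]; split => /=.
      rewrite -(mulgVK y w) -mulgA.
      by apply: (@powM 1 3) => //; exact: pow1.
    rewrite mulgA -[X in setpow W 3 X]mulgA.
    by apply: (@powM 1 2) => //; exact: pow1.
have step3 : \int[m]_z s [set y | Q (z, y)] <= m (setpow W 4) * (2%:E * s (setpow W 4)).
  have -> : m (setpow W 4) * (2%:E * s (setpow W 4)) =
     \int[m]_(z in setpow W 4) cst (2%:E * s (setpow W 4)) z.
    by rewrite integral_cst; [exact: muleC|exact: mB].
  rewrite [leRHS]integral_mkcond; apply: ge0_le_integral => //.
  - exact: measurable_section1.
  - by apply/(measurable_restrictT _ _).1; [exact: mB|exact: measurable_cst].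
  - move=> z _; rewrite /patch; case: ifPn => [/set_mem Az|Az]; last first.
      rewrite (_ : [set y | Q (z, y)] = set0) ?measure0//.
      by apply/seteqP; split => // y [/= Wz _]; move: Az; rewrite mem_set.
    rewrite /= !sE -(rtrans1 [set y | _]) -[in leRHS](rtrans1 (setpow W 4)).
    apply: (H3 z) => //; first exact: WK0.
      apply: (@open_comp _ _ (fun y : G => (z, y))) => // y _.
      by apply: cvg_pair; [exact: cvg_cst|exact: cvg_id].
    move=> w e Ww [_ /= We].
    have -> : (w * e = (w * (z * h)) * (e^-1 * z * h)^-1)%g.
      by rewrite !invgM !invgK !mulgA mulgK mulgK.
    by apply: (@powM 1 3); [exact: pow1|exact: powV].
have D1 := D 1%g; rewrite !rtrans1 -!sE in D1.
have Dx := D x; rewrite -!mE in Dx.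
have s2 : s (setpow W 2) \is a fin_num by exact: finE.
have m2 : m (setpow W 2) \is a fin_num by exact: finE.
have m2h : m (rtrans (setpow W 2) h) \is a fin_num by exact: finE.
have m4 : m (setpow W 4) \is a fin_num by exact: finE.
have s4 : s (setpow W 4) \is a fin_num by exact: finE.
have total : m (rtrans (setpow W 2) h) * s (setpow W 2) <=
   2%:E * (2%:E * (m (setpow W 4) * (2%:E * s (setpow W 4)))).
  apply: (le_trans step1); rewrite lee_wpmul2l//.
  by apply: (le_trans step2); rewrite lee_wpmul2l.
have p0 : 0 <= m (setpow W 2) by [].
have p4 : 0 <= m (setpow W 4) by [].
have q4 : 0 <= s (setpow W 4) by [].
move: total D1 Dx s1 p0 p4 q4.
rewrite -(fineK s2) -(fineK m2) -(fineK m2h) -(fineK m4) -(fineK s4).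
rewrite -!EFinM !lee_fin.
set m2h' := fine (m (rtrans _ _)); set s2' := fine (s (setpow W 2)).
set m2' := fine (m (setpow W 2)); set m4' := fine (m (setpow W 4)).
set s4' := fine (s (setpow W 4)); set n := (N%:R : R)%R.
have n0 : (0 <= n)%R by [].
clear - n0 => total D1 Dx s1 p0 p4 q4.
have s20 : (0 < s2')%R by lra.
rewrite -(ler_pM2r s20); apply: (le_trans total).
have := ler_pM p4 q4 Dx D1; nra.
Unshelve. all: end_near. Qed.

End harnack.

(** * The laws of the random walk *)

Section law_of_walk.
Context (R : realType) (G : topGroupType) (lcscG : lcsc G).
Local Notation B := (borel G).
Local Open Scope ereal_scope.

Let scG : @second_countable G. Proof. by case: lcscG. Qed.

Context (d : measure_display) (Omega : measurableType d)
  (P : probability Omega R) (Y : nat -> {RV P >-> borel G}).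
Variable mu : probability B R.
Hypothesis iidY : iid_of_law Y mu.

Definition walkb (n : nat) : Omega -> B := fun w => walk Y n w.

Lemma measurable_walk n : measurable_fun setT (walkb n).
Proof.
elim: n => [|n IH]; first exact: measurable_cst.
have mY : measurable_fun setT (Y n) by [].
have mp : measurable_fun setT (fun w => ((Y n w : B), walkb n w)).
  exact: measurable_fun_pair.
exact: (measurableT_comp (mul_borel lcscG) mp).
Qed.

HB.instance Definition _ n :=
  isMeasurableFun.Build _ _ Omega B (walkb n) (measurable_walk n).

Definition law (n : nat) : probability B R :=
  distribution P [the {mfun Omega >-> B} of walkb n].

Lemma lawE n A : law n A = P (walkb n @^-1` A).
Proof. by []. Qed.

Let ev (J : {fset nat}) (C : nat -> set B) : set Omega :=
  \bigcap_(i in [set` J]) (Y i @^-1` C i).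

Let mev J C : (forall i, measurable (C i)) -> measurable (ev J C).
Proof.
move=> mC; apply: bigcap_measurableType => i _.
by rewrite -[X in measurable X]setTI; apply: measurable_funP.
Qed.

Lemma measurable_walk_preimage n (C : set B) : measurable C ->
  measurable (walkb n @^-1` C).
Proof.
by move=> mC; rewrite -[X in measurable X]setTI; exact: measurable_walk.
Qed.


Lemma measurable_law_ltrans (n : nat) (C : set B) : measurable C ->
  measurable_fun setT (fun z : B => law n (ltrans C z)).
Proof.
move=> mC.
have mO : measurable ((fun z : B * B => ((z.1 : G) * (z.2 : G))%g : B) @^-1` C).
  by rewrite -[X in measurable X]setTI; exact: (mul_borel lcscG).
have := measurable_fun_xsection (law n) mO.
congr (measurable_fun _ _); apply/funext => x /=; congr (P _).
by apply/seteqP; split => y /=; rewrite /xsection /= inE.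
Qed.

(** If Y_n is independent of X_n on the event E given by later steps, then the
joint law of (Y_n, X_n) on E is a product measure, and X_{n+1} = Y_n X_n is
integrated by conditioning on Y_n. *)
Lemma walk_step n (J : {fset nat}) (C : nat -> set B) (D : set B) :
  (forall i, measurable (C i)) -> measurable D ->
  (forall A, measurable A -> forall A', measurable A' ->
     P (walkb n @^-1` A' `&` (Y n @^-1` A `&` ev J C)) =
     mu A * P (walkb n @^-1` A' `&` ev J C)) ->
  P (walkb n.+1 @^-1` D `&` ev J C) =
  \int[mu]_z P (walkb n @^-1` (ltrans D z) `&` ev J C).
Proof.
move=> mC mD IH.
have mE := mev J mC.
pose rP : {measure set Omega -> \bar R} := mrestr P mE.
have mw := measurable_walk n.
pose m2 : {measure set B -> \bar R} := pushforward rP (walkb n).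
have m2E A : m2 mw A = P (walkb n @^-1` A `&` ev J C) by [].
have [|m2' m2'E] := @finite_measure_ex _ B R (m2 mw).
  rewrite m2E; apply: le_lt_trans (probability_le1 P _) _; last exact: ltry.
  by apply: measurableI => //; exact: measurable_walk_preimage.
have mp : measurable_fun setT (fun w => ((Y n w : B), walkb n w)).
  by apply: measurable_fun_pair => //; exact: measurable_funP.
pose m3 : {measure set (B * B) -> \bar R} :=
  pushforward rP (fun w => ((Y n w : B), walkb n w)).
have mO : measurable ((fun z : B * B => ((z.1 : G) * (z.2 : G))%g : B) @^-1` D).
  by rewrite -[X in measurable X]setTI; exact: (mul_borel lcscG).
set X := _ @^-1` D in mO.
have H : (mu \x m2') X = m3 mp X.
  apply: product_measure_unique => // A A' mA mA'.
  change (m3 mp (A `*` A') = mu A * m2' A'); rewrite m2'E m2E -IH//.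
  transitivity (P ((fun w => ((Y n w : B), walkb n w)) @^-1` (A `*` A') `&` ev J C)).
    by [].
  congr (P _); apply/seteqP; split => w /=.
    by move=> [[? ?] ?]; split.
  by move=> [? [? ?]]; split.
transitivity (m3 mp X); first by [].
rewrite -H; apply: eq_integral => z _.
change (m2' (xsection X z) = P (walkb n @^-1` (ltrans D z) `&` ev J C)).
rewrite m2'E m2E; congr (P (_ `&` _)).
by apply/seteqP; split => w /=; rewrite /xsection /= inE.
Qed.

(** Independence is carried along the walk together with the product rule for
all later steps, since the latter is what the induction consumes. *)
Lemma walk_indep n (J : {fset nat}) (C : nat -> set B) (D : set B) :
  (forall i, measurable (C i)) -> measurable D ->
  (forall i, i \in J -> (n <= i)%N) ->
  P (walkb n @^-1` D `&` ev J C) = law n D * P (ev J C).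
Proof.
have [ind lawY] := iidY.
elim: n J C D => [|n IH] J C D mC mD Jn.
  rewrite lawE; have [D1|D1] := pselect (D (1%g : G)).
    have -> : walkb 0 @^-1` D = setT by apply/seteqP; split.
    by rewrite setTI (probability_setT P) mul1e.
  have -> : walkb 0 @^-1` D = set0 by apply/seteqP; split.
  by rewrite set0I measure0 mul0e.
have stepn (K : {fset nat}) : (forall i, i \in K -> (n < i)%N) ->
    P (walkb n.+1 @^-1` D `&` ev K C) = (\int[mu]_z law n (ltrans D z)) * P (ev K C).
  move=> Kn; rewrite walk_step//; last first.
    move=> A mA A' mA'.
    pose C' i := if i == n then A else C i.
    have nK : n \notin K by apply/negP => /Kn; rewrite ltnn.
    have C'E i : i \in K -> C' i = C i.
      by move=> iK; rewrite /C' ifN//; apply: contraNneq nK => <-.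
    have evE : Y n @^-1` A `&` ev K C = ev (n |` K)%fset C'.
      apply/seteqP; split => w.
        move=> [YA YC] i /=; rewrite in_fset1U => /orP[/eqP->|iK].
          by rewrite /C' eqxx.
        by rewrite C'E//; exact: YC.
      move=> h; split.
        by have := h n; rewrite /= in_fset1U eqxx /C' eqxx; exact.
      by move=> i /= iK; have := h i; rewrite /= in_fset1U iK orbT C'E//; exact.
    have mC' i : measurable (C' i) by rewrite /C'; case: ifP.
    have evKE : P (ev (n |` K)%fset C') = mu A * P (ev K C).
      rewrite /ev !ind// big_fsetU1//=; congr (_ * _).
        by rewrite /C' eqxx -(lawY n).
      rewrite big_seq [RHS]big_seq; apply: eq_bigr => i iK; rewrite C'E//.
    rewrite evE !IH//; first by rewrite evKE muleCA.
      by move=> i /Kn/ltnW.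
    by move=> i; rewrite in_fset1U => /orP[/eqP->//|/Kn/ltnW].
  rewrite muleC -ge0_integralZl//; last exact: measurable_law_ltrans.
  apply: eq_integral => z _; rewrite muleC IH//; first exact: measurable_ltrans.
  by move=> i /Kn/ltnW.
have := stepn fset0 _.
rewrite (_ : ev fset0 C = setT); last by apply/seteqP; split => // w _ i.
rewrite setIT (probability_setT P) mule1 => e; rewrite stepn// lawE e//.
Qed.

Lemma lawS n (D : set B) : measurable D ->
  law n.+1 D = \int[mu]_z law n (ltrans D z).
Proof.
have [ind lawY] := iidY.
move=> mD; pose C (i : nat) : set B := setT.
have e0 : ev fset0 C = setT by apply/seteqP; split => // w _ i.
have mC i : measurable (C i) by exact: measurableT.
have := @walk_step n fset0 C D mC mD; rewrite e0.
under eq_integral do rewrite setIT.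
rewrite setIT lawE => -> // A mA A' mA'; rewrite !setIT.
have e1 : Y n @^-1` A = ev [fset n]%fset (fun=> A).
  by apply/seteqP; split => w Yw => [i /= /fset1P->//|]; apply: (Yw n); rewrite /= in_fset1.
rewrite e1 walk_indep//; last by move=> i /fset1P->.
by rewrite /ev ind// big_seq_fset1 muleC -(lawY n).
Qed.

Lemma law0 (A : set B) : law 0 A = \d_(1%g : B) A.
Proof.
rewrite lawE diracE; have [A1|A1] := pselect (A (1%g : G)).
  rewrite mem_set//; have -> : walkb 0 @^-1` A = setT by apply/seteqP; split.
  exact: probability_setT.
rewrite memNset//; have -> : walkb 0 @^-1` A = set0 by apply/seteqP; split.
exact: measure0.
Qed.

(** [lawS] adds the last step on the left; by Fubini's theorem, convolution
powers may as well be built by adding the first step on the right. *)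
Lemma lawSr n (A : set G) : open A ->
  law n.+1 A = \int[mu]_z law n (rtrans A z).
Proof.
elim: n A => [|n IH] A oA.
  rewrite lawS; last exact: open_borel.
  apply: eq_integral => z _; rewrite !law0 !diracE.
  by congr ((nat_of_bool _)%:R%:E); apply/idP/idP => /set_mem h; apply/mem_set;
     move: h; rewrite /ltrans /rtrans /= mulg1 mul1g.
rewrite lawS; last exact: open_borel.
pose f (p : B * B) := law n (ltrans (rtrans A p.2) p.1).
have mf : measurable_fun setT f.
  pose X : set ((B * B) * B) := [set q | A ((q.1.1 : G) * q.2 * q.1.2)%g].
  have mX : measurable X.
    have m1 : measurable_fun [set: (B * B) * B]
        (fun q : (B * B) * B => ((q.1.1 : G) * q.2)%g : B).
      have mp : measurable_fun [set: (B * B) * B] (fun q : (B * B) * B => (q.1.1, q.2)).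
        apply: measurable_fun_pair => //.
        by apply: measurableT_comp => //; exact: measurable_fst.
      exact: (measurableT_comp (mul_borel lcscG) mp).
    have m2 : measurable_fun [set: (B * B) * B]
        (fun q : (B * B) * B => ((q.1.1 : G) * q.2 * q.1.2)%g : B).
      have mp : measurable_fun [set: (B * B) * B]
          (fun q : (B * B) * B => (((q.1.1 : G) * q.2)%g : B, q.1.2)).
        apply: measurable_fun_pair => //.
        by apply: measurableT_comp => //; exact: measurable_snd.
      exact: (measurableT_comp (mul_borel lcscG) mp).
    by have := m2 measurableT _ (open_borel oA); rewrite setTI.
  have := measurable_fun_xsection (law n) mX.
  congr (measurable_fun _ _); apply/funext => x /=; congr (P _).
  by apply/seteqP; split => y /=; rewrite /xsection /= inE.
transitivity (\int[mu]_z \int[mu]_w f (z, w)).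
  apply: eq_integral => z _; rewrite IH; last exact: open_ltrans.
  apply: eq_integral => w _; congr (law n _).
  by apply/seteqP; split => y; rewrite /ltrans /rtrans /= mulgA.
rewrite fubini_tonelli//; apply: eq_integral => w _.
by rewrite lawS//; apply: open_borel; exact: open_rtrans.
Qed.

Hypothesis recY : recurrent_walk Y.

(** By the Borel-Cantelli lemma, a convergent sum would forbid infinitely many returns. *)
Lemma law_recurrent (V : set G) : open V -> V 1%g -> \sum_(n <oo) law n V = +oo.
Proof.
move=> oV V1; apply: contrapT => noo.
have mV n : measurable (walkb n @^-1` V).
  by apply: measurable_walk_preimage; exact: open_borel.
have L0 := lim_sup_set_cvg0 (mu := P) mV _.
have {}L0 : P (lim_sup_set (fun n => walkb n @^-1` V)) = 0.
  by apply: L0; rewrite ltey; apply/eqP.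
have nV : nbhs (1%g : G) V by exact: open_nbhs_nbhs.
have mL : measurable (lim_sup_set (fun n => walkb n @^-1` V)).
  by apply: bigcap_measurableType => n _; apply: bigcup_measurable => k _.
have [N [mN N0 NS]] := recY nV.
have LN : setT `<=` lim_sup_set (fun n => walkb n @^-1` V) `|` N.
  move=> w _; have [Nw|Nw] := pselect (N w); [by right|left].
  have h : forall N, exists2 n, (N <= n)%N & V (walk Y n w).
    by apply: contrapT => h; apply: Nw; apply: NS.
  by move=> n _; have [k nk Vk] := h n; exists k.
have : P setT <= 0.
  have le1 : P setT <= P (lim_sup_set (fun n => walkb n @^-1` V) `|` N).
    by apply: le_measure; rewrite ?inE//; exact: measurableU.
  apply: (le_trans le1); apply: (le_trans (measureU2 _ mL mN)).
  rewrite [X in X <= _](_ : _ = 0)//.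
  transitivity (P (lim_sup_set (fun n => walkb n @^-1` V)) + 0).
    by congr (_ + _); exact: N0.
  by rewrite adde0; exact: L0.
by rewrite (probability_setT P) lee_fin ler10.
Qed.

Hypothesis adp : adapted mu.

Lemma law_recurrent_powers : recurrent_powers mu law.
Proof.
split => //.
- by move=> A _; exact: law0.
- by move=> n A; exact: lawSr.
- by move=> V; exact: law_recurrent.
Qed.

End law_of_walk.

(** * The Harnack inequality on a recurrent group *)

Section group_harnack.
Context (R : realType) (G : topGroupType) (lcscG : lcsc G).
Local Notation B := (borel G).
Local Open Scope ereal_scope.

(** The Harnack inequality in the form in which it is used: the measure s may
depend on h, whereas W and C do not. As [rtrans A x] is A x^-1, right
multiplication of x by h moves the set by h^-1. *)
Definition harnack_data (W K0 : set G) (C : R) :=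
  [/\ [/\ open W, W 1%g & forall w, W w -> W w^-1%g], compact K0, setpow W 8 `<=` K0,
   (0 < C)%R & forall h, exists s : {finite_measure set B -> \bar R},
     (forall x, s (rtrans (setpow W 2) (x * h)%g) <= C%:E * s (rtrans (setpow W 2) x)) /\
     (forall A : set G, open A -> A 1%g -> 1 <= s A)].

Lemma group_harnack : recurrent_group R G -> exists W K0 C, harnack_data W K0 C.
Proof.
move=> [mu [adp [d [T [P [Y [iidY recY]]]]]]].
have rs := law_recurrent_powers lcscG iidY recY adp.
have nuS' : forall k (A : set G), open A -> law lcscG Y k.+1 A = \int[mu]_z law lcscG Y k (ltrans A z).
  by move=> k A oA; apply: (lawS lcscG iidY); exact: open_borel.
have [_ lcG _] := lcscG.
have [K0 [nK0 cK0]] := lc_nbhs (1%g : G) lcG.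
have [W [oW W1 Wi WK]] := setpow_nbhs 8 nK0.
have WK4 : setpow W 4 `<=` K0 by move=> x x4; apply: WK; exact: setpow_le x4.
have [C C0 hC] := potential_harnack lcscG rs nuS' oW W1 Wi cK0 WK4.
exists W, K0, C; split => // h.
near (1%R : R)^'- => a.
have a01 : (0 < a < 1)%R.
  apply/andP; split; last by near: a; exact: nbhs_left_lt.
  by near: a; exact: nbhs_left_gt.
have Ha : forall x, potential (law lcscG Y) a (rtrans (setpow W 2) (x * h)%g) <=
    C%:E * potential (law lcscG Y) a (rtrans (setpow W 2) x).
  by near: a; exact: hC.
have [s sE] := potential_measure (law lcscG Y) a01.
exists s; split; first by move=> x; rewrite !sE.
by move=> A oA A1; rewrite sE; apply: (potential_ge1 rs) => //; case/andP: a01.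
Unshelve. all: end_near. Qed.

End group_harnack.

(** * Contraction groups *)

Lemma sum_disjoint d (T : measurableType d) (R : realType)
    (m : {measure set T -> \bar R}) (I : eqType) (s : seq I) (F : I -> set T) (A : set T) :
  uniq s -> (forall i, measurable (F i)) -> measurable A ->
  (forall i, i \in s -> F i `<=` A) ->
  (forall i j, i \in s -> j \in s -> F i `&` F j !=set0 -> i = j) ->
  (\sum_(i <- s) m (F i) <= m A)%E.
Proof.
move=> us mF; elim: s us A => [_ A mA _ _|i s IH /= /andP[nis us] A mA FA Fd].
  by rewrite big_nil.
rewrite big_cons; apply: (@le_trans _ _ (m (F i) + m (A `\` F i))%E).
  rewrite leeD2l//; apply: IH => //; first exact: measurableD.
    move=> j js x Fx; split; first by apply: (FA j) => //; rewrite inE js orbT.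
    move=> Fix; move: nis; rewrite (Fd i j) ?js// ?inE ?eqxx ?js ?orbT//.
    by exists x.
  by move=> j k js ks; apply: Fd; rewrite inE ?js ?ks orbT.
rewrite -measureU//; last 2 first.
- exact: measurableD.
- by apply/seteqP; split => // x [Fx []].
apply: le_measure; rewrite ?inE//; first by apply: measurableU => //; exact: measurableD.
by move=> x [Fx|[]//]; apply: (FA i) => //; rewrite inE eqxx.
Qed.

Section contraction.
Context (G : topGroupType) (lcscG : lcsc G) (g : G).
Local Notation C := (contracted g).

Let gconj (k : nat) (x : G) := (g ^+ k * x * g ^- k)%g.

Let conjM k x y : gconj k (x * y) = (gconj k x * gconj k y)%g.
Proof. by rewrite /gconj !mulgA mulgVK. Qed.

Let conjV k x : gconj k x^-1 = (gconj k x)^-1%g.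
Proof. by rewrite /gconj !invgM invgK !mulgA. Qed.

Let conj1 k : gconj k 1 = 1%g.
Proof. by rewrite /gconj mulg1 mulgV. Qed.

Let conjS k m x : gconj k (gconj m x) = gconj (k + m) x.
Proof. by rewrite /gconj expgnDr invgM !mulgA. Qed.

Let continuous_conj k : continuous (gconj k).
Proof.
apply: continuousMg => x; last exact: cvg_cst.
by apply: cvgMg; [exact: cvg_cst|exact: cvg_id].
Qed.

Lemma contracted1 : C 1%g.
Proof.
rewrite /contracted /= (_ : (fun n => _) = fun=> 1%g); first exact: cvg_cst.
by apply/funext => n; exact: conj1.
Qed.

Lemma contractedM x y : C x -> C y -> C (x * y)%g.
Proof.
move=> Cx Cy; have : (fun n => gconj n x * gconj n y)%g @ \oo --> (1 * 1 : G)%g by exact: cvgMg.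
by rewrite mulg1 /contracted /=; under eq_fun do rewrite -conjM.
Qed.

Lemma contractedV x : C x -> C x^-1%g.
Proof.
move=> Cx; have : (fun n => (gconj n x)^-1)%g @ \oo --> (1^-1 : G)%g by exact: cvgVg.
by rewrite invg1 /contracted /=; under eq_fun do rewrite -conjV.
Qed.

Lemma contracted_conj m x : C (gconj m x) <-> C x.
Proof.
rewrite /contracted /= -/(gconj _ _).
have -> : (fun n => g ^+ n * gconj m x * g ^- n)%g = (fun n => gconj (n + m) x).
  by apply/funext => n; rewrite -conjS.
have -> : (fun n => g ^+ n * x * g ^- n)%g = (fun n => gconj n x) by [].
by rewrite (cvg_shiftn m (fun n => gconj n x)).
Qed.

Lemma closure_setpow2 (V : set G) : open V -> (forall v, V v -> V v^-1%g) -> V 1%g ->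
  closure V `<=` setpow V 2.
Proof.
move=> oV Vi V1 x clx.
have [|v [Vv /= xv]] := clx (ltrans V x^-1%g).
  by apply: open_nbhs_nbhs; split; [exact: open_ltrans|rewrite /ltrans /= mulVg].
have -> : x = (v * (x^-1 * v)^-1)%g by rewrite invgM invgK mulgA mulgV mul1g.
by apply: (@setpowM _ _ 1 1); apply: setpow1 => //; exact: Vi.
Qed.

(** By Baire's theorem, for some n the conjugates of index at least n of all
points in a nonempty relatively open part of the contraction group stay near 1;
translating this part within the group covers a neighbourhood of any point,
and compactness concludes. *)
Lemma uniform_contraction (Q U : set G) : closed C -> compact Q -> Q `<=` C -> nbhs 1%g U ->
  \forall k \near \oo, forall x, Q x -> U (gconj k x).
Proof.
move=> clC cQ QC nU; have [hG lcG _] := lcscG.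
have [V [oV V1 Vi VU]] := setpow_nbhs 4 nU.
pose F n : set G := \bigcap_(k in [set k | (n <= k)%N]) (gconj k @^-1` closure V).
have clF n : closed (F n).
  apply: closed_bigI => k _; apply: closed_comp; last exact: closed_closure.
  by move=> x _; exact: continuous_conj.
have nV : nbhs 1%g V by exact: open_nbhs_nbhs.
have C0 : C !=set0 by exists 1%g; exact: contracted1.
have CF : C `<=` \bigcup_n F n.
  move=> x Cx; have [n _ nP] : \forall k \near \oo, V (gconj k x) by exact: Cx.
  by exists n => // k nk; apply: subset_closure; exact: nP.
have [n [Om [oO [x0 [Ox0 Cx0]] OF]]] := baire_closed hG lcG C0 clC clF CF.
have /compact_near_coveringP ncQ := cQ.
have H : \forall k \near \oo, Q `<=` (fun y => C y -> U (gconj k y)).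
  apply: ncQ => x Qx; have Cx := QC _ Qx.
  have nx : \forall y \near x, Om (x0 * x^-1 * y)%g.
    have : (fun y => x0 * x^-1 * y)%g @ x --> (x0 * x^-1 * x)%g.
      exact: continuous_mull.
    apply; rewrite mulgVK; exact: open_nbhs_nbhs.
  have nk : \forall k \near \oo, [/\ (n <= k)%N, V (gconj k x) & V (gconj k x0)].
    near=> k; split.
    - by near: k; exists n.
    - by near: k; exact: Cx.
    - by near: k; exact: Cx0.
  exists ([set y | Om (x0 * x^-1 * y)%g], [set k | [/\ (n <= k)%N, V (gconj k x) & V (gconj k x0)]]).
    by split.
  move=> [y k] [/= Oy [nk' Vx Vx0]] Cy; apply: VU.
  have Cz : C (x0 * x^-1 * y)%g.
    by apply: contractedM => //; apply: contractedM => //; exact: contractedV.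
  have z2 := closure_setpow2 oV Vi V1 (OF _ (conj Oy Cz) k nk').
  have -> : y = (x * x0^-1 * (x0 * x^-1 * y))%g by rewrite !mulgA mulgVK mulgV mul1g.
  rewrite conjM [gconj k (x * _)]conjM conjV; apply: (@setpowM _ _ 2 2) => //.
  by apply: (@setpowM _ _ 1 1); apply: setpow1 => //; exact: Vi.
apply: filterS H => k H x Qx; apply: H => //; exact: QC.
Unshelve. all: end_near. Qed.

Lemma avoid_seq (s : seq G) : (forall z, z \in s -> z != 1%g) ->
  exists A, nbhs 1%g A /\ forall z, z \in s -> ~ A z.
Proof.
have [hG _ _] := lcscG.
elim: s => [_|z s IH H]; first by exists setT; split => //; exact: filterT.
have [|A [nA As]] := IH; first by move=> y ys; apply: H; rewrite inE ys orbT.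
have z1 : (1%g : G) != z by rewrite eq_sym; apply: H; rewrite inE eqxx.
have [D nD Dz] := hausdorff_sep hG z1.
exists (A `&` D); split; first exact: filterI.
by move=> y; rewrite inE => /orP[/eqP->[_]//|/As nAy [/nAy]].
Qed.

(** The iterated conjugates of a point x <> 1 tend to 1 without reaching it. *)
Lemma contracted_many x : C x -> x != 1%g -> forall M U, nbhs 1%g U ->
  exists s : seq G, [/\ uniq s, size s = M &
     forall z, z \in s -> [/\ C z, U z & z != 1%g]].
Proof.
move=> Cx x1; elim=> [|M IH] U nU; first by exists [::].
have [s [us ss sP]] := IH U nU.
have [A [nA As]] : exists A, nbhs 1%g A /\ forall z, z \in s -> ~ A z.
  by apply: avoid_seq => z /sP[].
have [n _ nP] : \forall k \near \oo, (U `&` A) (gconj k x).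
  by apply: Cx; exact: filterI.
have [Uy Ay] := nP n (leqnn n).
exists (gconj n x :: s); split => //=.
- by rewrite us andbT; apply/negP => /As.
- by rewrite ss.
- move=> z; rewrite inE => /orP[/eqP->|/sP//]; split => //.
    exact/contracted_conj.
  apply: contra_neq x1 => h.
  have : gconj n x = gconj n 1%g by rewrite h conj1.
  by rewrite /gconj => /mulIg/mulgI.
Qed.

End contraction.

Section digits.
Context (G : topGroupType) (h : G) (F : seq G).

Fixpoint words (J : nat) : seq (seq G) :=
  if J is j.+1 then [seq x :: t | x <- F, t <- words j] else [:: [::]].

(** For w = x_0 x_1 ... this is x_0 (h x_1 h^-1) (h^2 x_2 h^-2) ..., an
expansion with digits x_i in base h; multiplied by h^J, where J is the length
of w, it becomes the product of the x_i h. *)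
Fixpoint expand (w : seq G) : G :=
  if w is x :: t then (x * (h * expand t * h^-1))%g else 1%g.

Lemma size_words J : size (words J) = (size F ^ J)%N.
Proof. by elim: J => //= j IH; rewrite size_allpairs IH expnS. Qed.

Lemma uniq_words J : uniq F -> uniq (words J).
Proof.
move=> uF; elim: J => //= j IH; apply: allpairs_uniq => //.
by move=> [x t] [y u] _ _ [-> ->].
Qed.

Lemma words_cons J w : w \in words J.+1 ->
  exists x t, [/\ w = x :: t, x \in F & t \in words J].
Proof. by move=> /= /allpairsP[[x t] [/= xF tJ ->]]; exists x, t. Qed.

End digits.

Section contracted_trivial.
Context (R : realType) (G : topGroupType) (lcscG : lcsc G) (g : G).
Variables (W K0 : set G) (C0 : R).
Hypothesis hd : harnack_data W K0 C0.
Local Notation C := (contracted g).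

(** When h contracts strongly enough, digit expansions stay in W^2 and the
first digit on which two words differ is not compensated by the later ones.
So the sets W^2 (p h^J)^-1, p the expansion of a word of length J, are
disjoint, and J steps of the Harnack inequality contradict the exponential
number of words. *)
Lemma contracted_trivial : closed C -> C = [set 1%g].
Proof.
move=> clC; apply/seteqP; split=> [x Cx /=|x ->]; last exact: contracted1.
apply: contrapT => /eqP x1.
have [[oW W1 Wi] cK0 WK0 C00 hC] := hd.
have oWn n : open (setpow W n.+1) by exact: setpow_open.
have nW : nbhs 1%g W by exact: open_nbhs_nbhs.
(* at least 2 C0 digits, so that the number of words beats the constants C0 ^ J *)
pose M := (Num.trunc (2 * C0)%R).+1.
have MC : (2 * C0 <= M%:R :> R)%R by rewrite ltW// truncnS_gt.
have [F [uF sF FP]] := contracted_many lcscG Cx x1 M nW.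
pose D := [seq y <- [seq (x^-1 * y)%g | x <- F, y <- F] | y != 1%g].
have [A [nA AD]] : exists A, nbhs 1%g A /\ forall z, z \in D -> ~ A z.
  by apply: (avoid_seq lcscG) => z; rewrite mem_filter => /andP[].
have cQ : compact (C `&` K0).
  rewrite setIC; exact: compact_closedI.
have [n _ nP] : \forall k \near \oo, forall x, (C `&` K0) x ->
    (W `&` A) (g ^+ k * x * g ^- k)%g.
  by apply: (uniform_contraction lcscG clC cQ); [move=> ? []|exact: filterI].
set h := (g ^+ n)%g.
have hP y : C y -> setpow W 8 y -> W (h * y * h^-1)%g /\ A (h * y * h^-1)%g.
  by move=> Cy y8; apply: (nP n (leqnn n)); split => //; exact: WK0.
have CM y z : C y -> C z -> C (y * z)%g by exact: contractedM.
have CV y : C y -> C y^-1%g by exact: contractedV.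
have Ch y : C (h * y * h^-1)%g <-> C y by exact: contracted_conj.
have expP J w : w \in words F J -> C (expand h w) /\ setpow W 2 (expand h w).
  elim: J w => [w|J IH w /words_cons[y [t [-> yF tJ]]]].
    rewrite inE => /eqP -> /=; split; first exact: contracted1.
    by apply: (@setpow_le _ _ 0).
  have [Ct Wt] := IH t tJ; have [Cy Wy _] := FP y yF; split.
    by apply: (@CM) => //; exact/Ch.
  apply: (@setpowM _ _ 1 1); apply: setpow1 => //.
  by have [] := hP _ Ct (setpow_le W1 (isT : 2 <= 8)%N Wt).
have small j e : C e -> setpow W 4 e -> C (h ^+ j * e * h ^- j)%g /\
    setpow W 4 (h ^+ j * e * h ^- j)%g.
  move=> Ce e4; elim: j => [|j [Cj j4]].
    by rewrite expg0 invg1 mulg1 mul1g.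
  have -> : (h ^+ j.+1 * e * h ^- j.+1 = h * (h ^+ j * e * h ^- j) * h^-1)%g.
    by rewrite expgS invgM !mulgA.
  split; first exact/Ch.
  have [Wj _] := hP _ Cj (setpow_le W1 (isT : 4 <= 8)%N j4).
  by apply: (setpow_le W1 (isT : 1 <= 4)%N); exact: setpow1.
(* different words have expansions that remain apart at scale h ^ J *)
have sep J w w' : w \in words F J -> w' \in words F J ->
    setpow W 4 (h ^- J * ((expand h w)^-1 * expand h w') * h ^+ J)%g -> w = w'.
  elim: J w w' => [w w'|J IH w w' /words_cons[y [t [-> yF tJ]]]
      /words_cons[y' [t' [-> yF' tJ']]] /=].
    by rewrite !inE => /eqP -> /eqP ->.
  set E := (X in setpow W 4 X).
  have [Ct Wt] := expP _ _ tJ; have [Ct' Wt'] := expP _ _ tJ'.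
  have [Cy Wy _] := FP y yF; have [Cy' Wy' _] := FP y' yF'.
  have EE : E = (h ^- J * ((expand h t)^-1 * (h^-1 * (y^-1 * y') * h) * expand h t') * h ^+ J)%g.
    by rewrite /E expgS !invgM !invgK !mulgA !mulgVK.
  have [eyy'|nyy'] := eqVneq y y'.
    move=> E4; rewrite eyy'; congr cons; apply: IH => //.
    by move: E4; rewrite EE eyy' mulVg mulg1 mulVg mulg1.
  move=> E4.
  have CE : C E.
    have Cin m z : C z -> C (h ^- m * z * h ^+ m)%g.
      move=> Cz; have := @contracted_conj _ g (n * m) (h ^- m * z * h ^+ m)%g.
      rewrite expgnA -/h !mulgA mulgV mul1g mulgK => -[+ _]; exact.
    apply: (Cin J.+1); apply: (@CM); last by apply: (@CM) => //; exact/Ch.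
    by apply: (@CV); apply: (@CM) => //; exact/Ch.
  have [Cs s4] := small J _ CE E4.
  set S := (h ^+ J * E * h ^- J)%g in Cs s4.
  have SE : (y^-1 * y' = h * (expand h t * S * (expand h t')^-1) * h^-1)%g.
    have -> : S = ((expand h t)^-1 * (h^-1 * (y^-1 * y') * h) * expand h t')%g.
      by rewrite /S EE !mulgA mulgV mul1g mulgK.
    rewrite -[((expand h t)^-1 * _ * _)%g]mulgA mulVKg mulgK.
    by rewrite -[(h^-1 * _ * _)%g]mulgA mulVKg mulgK.
  have C8 : C (expand h t * S * (expand h t')^-1)%g.
    by apply: (@CM); [exact: (@CM)|exact: (@CV)].
  have W8 : setpow W 8 (expand h t * S * (expand h t')^-1)%g.
    by apply: (@setpowM _ _ 6 2); [exact: (@setpowM _ _ 2 4)|exact: setpowV].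
  have [_] := hP _ C8 W8; rewrite -SE => Ayy'; exfalso.
  apply: (AD (y^-1 * y')%g) => //; rewrite mem_filter; apply/andP; split.
    by apply: contra_neq nyy' => e; rewrite -[y'](mulVKg y) e mulg1.
  by apply/allpairsP; exists (y, y').
have [s [sC s1]] := hC h^-1%g.
have iter_s J z : (s (rtrans (setpow W 2) z) <= (C0 ^+ J)%:E * s (rtrans (setpow W 2) (z * h ^+ J)%g))%E.
  elim: J => [|J IH]; first by rewrite expr0 mul1e expg0 mulg1.
  apply: (le_trans IH); rewrite exprSr EFinM -muleA lee_wpmul2l//.
    by rewrite lee_fin exprn_ge0// ltW.
  by have := sC (z * h ^+ J.+1)%g; rewrite expgSr mulgA mulgK.
have mW (z : G) : measurable (rtrans (setpow W 2) z : set (borel G)).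
  by apply: open_borel; exact: open_rtrans.
have sfin : s setT \is a fin_num by apply: fin_num_measure.
set S := fine (s setT).
have bound J : (M%:R ^+ J <= C0 ^+ J * S :> R)%R.
  rewrite -lee_fin EFinM fineK//.
  apply: (@le_trans _ _ (\sum_(w <- words F J) s (rtrans (setpow W 2) (expand h w)))%E).
    rewrite -natrX -sF -size_words.
    apply: (@le_trans _ _ (\sum_(w <- words F J) 1%E)%E).
      by rewrite big_const_seq count_predT iter_addr addr0 -[leRHS]mule_natl mule1.
    rewrite big_seq [leRHS]big_seq; apply: lee_sum => w wJ.
    apply: s1; first exact: open_rtrans.
    by rewrite /rtrans /= mul1g; have [] := expP J w wJ.
  apply: (@le_trans _ _ (\sum_(w <- words F J)
      (C0 ^+ J)%:E * s (rtrans (setpow W 2) (expand h w * h ^+ J)%g))%E).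
    by apply: lee_sum => w _; exact: iter_s.
  rewrite -ge0_sume_distrr//; apply: lee_wpmul2l.
    by rewrite lee_fin exprn_ge0// ltW.
  apply: (@sum_disjoint _ (borel G) R s _ _
    (fun w => rtrans (setpow W 2) (expand h w * h ^+ J)%g)) => //.
    exact: uniq_words.
  move=> w w' wJ w'J [y [/= Wy Wy']]; apply: (sep J) => //.
  have -> : (h ^- J * ((expand h w)^-1 * expand h w') * h ^+ J =
     (y * (expand h w * h ^+ J))^-1 * (y * (expand h w' * h ^+ J)))%g.
    by rewrite !invgM !mulgA mulgVK.
  by apply: (@setpowM _ _ 2 2) => //; exact: setpowV.
pose J := (Num.trunc S).+1.
have SJ : (S < J%:R)%R by rewrite truncnS_gt.
have : ((2 * C0) ^+ J <= C0 ^+ J * S :> R)%R.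
  apply: le_trans (bound J); rewrite lerXn2r// ?nnegrE//.
  by rewrite mulr_ge0// ltW.
rewrite exprMn mulrC ler_pM2l ?exprn_gt0// => le2.
have : (J%:R <= 2 ^+ J :> R)%R by rewrite -natrX ler_nat ltnW// ltn_expl.
by move=> /le_trans-/(_ _ le2); rewrite leNgt SJ.
Qed.

End contracted_trivial.

(** * Uniqueness of Haar measure *)

(** A copy of the measure, on which sigma-finiteness can be declared as an
instance. *)
Definition sigma_finite_copy d (T : measurableType d) (R : realType)
  (m : {measure set T -> \bar R}) of sigma_finite setT m : set T -> \bar R := m.

Section sigma_finite_copy.
Context d (T : measurableType d) (R : realType) (m : {measure set T -> \bar R}).
Hypothesis mfin : sigma_finite setT m.

HB.instance Definition _ := Measure.copy (sigma_finite_copy mfin) m.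
HB.instance Definition _ := Measure_isSigmaFinite.Build _ _ _ (sigma_finite_copy mfin) mfin.

End sigma_finite_copy.

Lemma sigma_finite_measure_ex d (T : measurableType d) (R : realType)
  (m : {measure set T -> \bar R}) : sigma_finite setT m ->
  exists m' : {sigma_finite_measure set T -> \bar R}, forall A, m' A = m A.
Proof. by move=> fin; exists (sigma_finite_copy fin). Qed.

Section haar_unique.
Context (R : realType) (G : topGroupType) (lcscG : lcsc G).
Local Notation B := (borel G).
Local Open Scope ereal_scope.

Let scG : @second_countable G. Proof. by case: lcscG. Qed.

Definition ltrans_invariant (m : set B -> \bar R) :=
  forall (g : G) (A : set B), measurable A -> m (ltrans A g) = m A.

Lemma left_invariantP (m : {measure set B -> \bar R}) : left_invariant m -> ltrans_invariant m.
Proof.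
move=> li g A mA; rewrite -[RHS](li g^-1%g A mA); congr (m _).
apply/seteqP; split => [x Ax|_ [x Ax <-]]; last by rewrite /ltrans /= mulVKg.
by exists (g * x)%g => //; rewrite mulKg.
Qed.

Lemma ltrans_invariant_integral (m : {measure set B -> \bar R}) (g : G) (f : B -> \bar R) :
  ltrans_invariant m -> measurable_fun setT f -> (forall x, 0 <= f x) ->
  \int[m]_x f (g * (x : G))%g = \int[m]_x f x.
Proof.
move=> li mf f0.
pose phi : B -> B := fun x => (g * (x : G))%g.
have mphi : measurable_fun setT phi := continuous_borel (@continuous_mull G g).
have := @ge0_integral_pushforward _ _ B B R phi mphi m setT f measurableT mf _.
rewrite preimage_setT => <-; last by move=> x _.
pose pm : {measure set B -> \bar R} := pushforward m phi.
rewrite (eq_measure_integral m (m1 := pm mphi))// => A mA _.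
exact: li.
Qed.

Variables (m m' : {sigma_finite_measure set B -> \bar R}).
Hypothesis (lm : ltrans_invariant m) (lm' : ltrans_invariant m').

(** The weight q inverts x -> m (A x^-1), so that the value of m' at E is the
double integral of 1_E(x) q(x) 1_A(y x). Translating x by y^-1 under m', then
y by x under m, the integrand becomes 1_A(x) 1_E(y^-1) q(y^-1): the
dependence on m' is only through its value at A. *)
Lemma ltrans_invariant_formula (A : set G) (q : B -> R) : open A ->
  measurable_fun setT q -> (forall x, (0 <= q x)%R) ->
  (forall x, (q x)%:E * m (rtrans A x) = 1) ->
  forall E : set B, measurable E ->
  m' E = m' A * \int[m]_y ((\1_E (y : G)^-1%g : R) * q (y : G)^-1%g)%:E.
Proof.
move=> oA mq q0 qd E mE; have mA : measurable (A : set B) by exact: open_borel.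
pose F (x : B) : \bar R := (\1_E x * q x)%:E.
have mF : measurable_fun setT F by apply/measurable_EFinP; exact: measurable_funM.
have F0 x : 0 <= F x by rewrite lee_fin mulr_ge0.
have m1A : measurable_fun [set: B] (fun x : B => (\1_A x : R)%:E).
  exact/measurable_EFinP.
have m1A2 : measurable_fun [set: B * B]
    (fun p : B * B => (\1_A ((p.2 : G) * (p.1 : G))%g : R)%:E).
  have mm : measurable_fun [set: B * B]
      ((fun p : G * G => (p.2 * p.1)%g) : B * B -> B).
    by apply: continuous_borel_prod => // p; apply: cvgMg; [exact: cvg_snd|exact: cvg_fst].
  exact: (measurableT_comp m1A mm).
pose Phi (p : B * B) : \bar R := F p.1 * (\1_A ((p.2 : G) * (p.1 : G))%g : R)%:E.
have mPhi : measurable_fun setT Phi.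
  apply: emeasurable_funM => //.
  exact: (measurableT_comp mF (@measurable_fst _ _ B B)).
have Phi0 p : 0 <= Phi p by rewrite mule_ge0// lee_fin.
have -> : m' E = \int[m']_x \int[m]_y Phi (x, y).
  have -> : m' E = \int[m']_x (\1_E x)%:E by rewrite integral_indic// setIT.
  apply: eq_integral => x _; rewrite /Phi /=.
  rewrite ge0_integralZl//; last first.
    apply/measurable_EFinP; have mx := continuous_borel (@continuous_mulr G x).
    by have /measurable_EFinP := measurableT_comp m1A mx.
  have -> : \int[m]_y (\1_A ((y : G) * (x : G))%g : R)%:E = m (rtrans A x).
    have mr := measurable_rtrans x mA.
    have -> : m (rtrans A x) = \int[m]_y (\1_(rtrans A x) y)%:E.
      by rewrite integral_indic// setIT.
    by apply: eq_integral => y _; rewrite !indicE.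
  by rewrite /F EFinM -muleA qd mule1.
rewrite fubini_tonelli//.
pose Psi (p : B * B) : \bar R := F ((p.2 : G)^-1 * (p.1 : G))%g * (\1_A p.1)%:E.
have mFi : measurable_fun [set: B * B] (fun p : B * B => F ((p.2 : G)^-1 * (p.1 : G))%g).
  have mm : measurable_fun [set: B * B]
      ((fun p : G * G => (p.2^-1 * p.1)%g) : B * B -> B).
    apply: continuous_borel_prod => // p; apply: cvgMg; last exact: cvg_fst.
    by apply: cvgVg; exact: cvg_snd.
  exact: (measurableT_comp mF mm).
have mPsi : measurable_fun setT Psi.
  apply: emeasurable_funM => //.
  exact: (measurableT_comp m1A (@measurable_fst _ _ B B)).
have Psi0 p : 0 <= Psi p by rewrite mule_ge0// lee_fin.
have -> : \int[m]_y \int[m']_x Phi (x, y) = \int[m]_y \int[m']_x Psi (x, y).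
  apply: eq_integral => y _.
  have <- := @ltrans_invariant_integral m' y (fun x => Psi (x, y)) lm' _ _; last 2 first.
  - exact: (measurableT_comp mPsi (measurable_pair2 y)).
  - by move=> x.
  by apply: eq_integral => x _; rewrite /Psi /Phi /= mulKg.
rewrite -fubini_tonelli//.
have mFinv : measurable_fun [set: B] (fun y : B => F ((y : G)^-1)%g).
  have mi := continuous_borel (@invg_continuous G).
  exact: (measurableT_comp mF mi).
set J := \int[m]_y _.
transitivity (\int[m']_x ((\1_A x)%:E * J)).
  apply: eq_integral => x _; rewrite /Psi /=.
  under eq_integral do rewrite muleC.
  rewrite ge0_integralZl ?lee_fin//; last first.
    have := measurableT_comp mFi (measurable_pair1 x); exact.
  congr (_ * _); rewrite /J.
  have <- := @ltrans_invariant_integral m x^-1%g (fun y => F ((y : G)^-1)%g) lm mFinv _; last first.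
    by move=> y.
  by apply: eq_integral => y _; rewrite invgM invgK.
have J0 : 0 <= J by apply: integral_ge0 => y _; exact: F0.
under eq_integral do rewrite muleC.
by rewrite ge0_integralZl// integral_indic// setIT muleC.
Qed.

End haar_unique.

Section haar_facts.
Context (R : realType) (G : topGroupType) (lcscG : lcsc G).
Local Notation B := (borel G).
Local Open Scope ereal_scope.

Let scG : @second_countable G. Proof. by case: lcscG. Qed.

Definition haar (m : {measure set B -> \bar R}) :=
  [/\ ltrans_invariant m, (forall K : set G, compact K -> m K < +oo) & m setT != 0].

Lemma left_haarP (m : {measure set B -> \bar R}) : left_haar m -> haar m.
Proof. by move=> [li fK nz]; split => //; exact: left_invariantP. Qed.

Lemma compact_borel (K : set G) : compact K -> measurable (K : set B).
Proof.
have [hG _ _] := lcscG; move=> /(compact_closed hG) clK.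
rewrite -[K]setCK; apply: measurableC; apply: open_borel; exact: closed_openC.
Qed.

Lemma haar_lty (m : {measure set B -> \bar R}) (U K : set G) : haar m -> open U ->
  compact K -> U `<=` K -> m U < +oo.
Proof.
move=> [_ fK _] oU cK UK; apply: le_lt_trans (fK _ cK).
by apply: le_measure; rewrite ?inE//; [exact: open_borel|exact: compact_borel].
Qed.

Lemma haar_sigma_finite (m : {measure set B -> \bar R}) : haar m -> sigma_finite setT m.
Proof.
move=> hm; have [_ lcG _] := lcscG.
have [f [fo fK fT]] := lcsc_exhaustion lcG scG.
exists f; first by rewrite fT.
move=> n; split; first exact: open_borel.
have [K cK fnK] := fK n; exact: haar_lty hm (fo n) cK fnK.
Qed.

(** Countably many translates of U cover the group, so that U cannot be
negligible. *)
Lemma haar_open_gt0 (m : {measure set B -> \bar R}) (U : set G) : haar m ->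
  open U -> U !=set0 -> 0 < m U.
Proof.
move=> [li _ /eqP nz] oU [u Uu]; rewrite lt0e measure_ge0 andbT; apply/eqP => U0.
apply: nz.
have mT : measurable [set: B] by [].
have : exists f : nat -> set G, [/\ forall n, open (f n),
    forall n, m.-negligible (f n : set B) & \bigcup_n f n = setT].
  apply: (lindelof (P := fun A : set G => m.-negligible (A : set B))) => //.
  - exact: negligible_set0.
  - by move=> A D DA; exact: negligibleS.
  - move=> x; exists (ltrans U (u * x^-1)%g).
      by apply: open_nbhs_nbhs; split; [exact: open_ltrans|rewrite /ltrans /= mulgVK].
    exists (ltrans U (u * x^-1)%g); split => //.
      by apply: open_borel; exact: open_ltrans.
    by rewrite li//; exact: open_borel.
move=> [f [fo fP fT]].
have [N [mN N0 TN]] : m.-negligible [set: B] by rewrite -fT; exact: negligible_bigcup.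
by rewrite (_ : [set: B] = N)//; apply/seteqP; split.
Qed.

Lemma haar_mulr (m : {measure set B -> \bar R}) (h : G) : haar m ->
  exists m' : {measure set B -> \bar R}, haar m' /\ forall E, m' E = m (rtrans E h).
Proof.
move=> [li fK nz].
pose phi : B -> B := fun x => ((x : G) * h)%g.
have mphi : measurable_fun setT phi := continuous_borel (@continuous_mulr G h).
pose pm : {measure set B -> \bar R} := pushforward m phi.
exists (pm mphi); split => //; split.
- move=> g A mA; transitivity (m (ltrans (rtrans A h) g)).
    transitivity (m (rtrans (ltrans A g) h)); first by [].
    by congr (m _); apply/seteqP; split => x; rewrite /rtrans /ltrans /= mulgA.
  by rewrite li//; exact: measurable_rtrans.
- move=> K cK; have -> : pm mphi K = m [set (x * h^-1)%g | x in K].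
    transitivity (m (rtrans K h)); first by [].
    congr (m _); apply/seteqP; split => [x Kx|_ [x Kx <-]].
      by exists (x * h)%g => //; rewrite mulgK.
    by rewrite /rtrans /= mulgVK.
  apply: fK; apply: continuous_compact => //; apply: continuous_subspaceT.
  exact: continuous_mulr.
- by [].
Qed.

(** The right translate of m by h is again a Haar measure, and by
[ltrans_invariant_formula] both are determined by their values at A. *)
Lemma haar_modular (m : {measure set B -> \bar R}) (h : G) : haar m ->
  exists2 c : R, (0 < c)%R & forall E : set B, measurable E ->
    m (rtrans E h) = c%:E * m E.
Proof.
move=> hm; have [_ lcG _] := lcscG.
have [K [nK cK]] := lc_nbhs (1%g : G) lcG.
move: nK; rewrite nbhsE => -[A [oA A1] AK].
have dpos x : 0 < m (rtrans A x).
  apply: haar_open_gt0 => //; first exact: open_rtrans.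
  by exists x^-1%g; rewrite /rtrans /= mulVg.
have dlty x : m (rtrans A x) < +oo.
  have cKx : compact [set (k * x^-1)%g | k in K].
    apply: continuous_compact => //; apply: continuous_subspaceT.
    exact: continuous_mulr.
  apply: (haar_lty hm _ cKx); first exact: open_rtrans.
  by move=> y Ayx; exists (y * x)%g; [exact: AK|rewrite mulgK].
have dfin x : m (rtrans A x) \is a fin_num.
  by rewrite ge0_fin_numE.
have [sm smE] := sigma_finite_measure_ex (haar_sigma_finite hm).
have [m' [hm' m'E]] := haar_mulr h hm.
have [sm' sm'E] := sigma_finite_measure_ex (haar_sigma_finite hm').
pose q (x : B) : R := (fine (sm (rtrans A x)) `^ (-1))%R.
have mq : measurable_fun setT q.
  have md := measurable_fun_rtrans lcscG sm oA.
  have mf := measurableT_comp (@fine_measurable R setT measurableT) md.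
  exact: (measurableT_comp (@measurable_powR R (-1)) mf).
have q0 x : (0 <= q x)%R by exact: powR_ge0.
have qd x : (q x)%:E * sm (rtrans A x) = 1.
  rewrite /q smE powR_inv1 ?fine_ge0//.
  rewrite -[X in _ * X](fineK (dfin x)) -EFinM mulVf//.
  by rewrite gt_eqF// fine_gt0// dpos dlty.
have lsm : ltrans_invariant sm by move=> g E mE; rewrite !smE; case: hm => li _ _; exact: li.
have lsm' : ltrans_invariant sm' by move=> g E mE; rewrite !sm'E; case: hm' => li _ _; exact: li.
have f1 := ltrans_invariant_formula lcscG lsm lsm oA mq q0 qd.
have f2 := ltrans_invariant_formula lcscG lsm lsm' oA mq q0 qd.
have A0 : m A = m (rtrans A 1%g) by rewrite rtrans1.
have fA : m A \is a fin_num by rewrite A0.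
have pA : (0 < fine (m A))%R by rewrite A0 fine_gt0// dpos dlty.
exists (fine (m (rtrans A h)) / fine (m A))%R.
  by rewrite divr_gt0// fine_gt0// dpos dlty.
move=> E mE; have := f2 E mE; have := f1 E mE.
rewrite !sm'E !m'E !smE => -> ->; rewrite muleA; congr (_ * _).
by rewrite -[X in _ = _ * X](fineK fA) -EFinM divfK ?gt_eqF// fineK.
Qed.

End haar_facts.

(** * Closed subgroups are unimodular *)

Section subgroup_topology.
Context (G : topGroupType) (lcscG : lcsc G).
Context (H : set G) (sgH : subgroup H).
Local Notation S := (subgroup_type sgH).

Lemma val_continuous : continuous (val : S -> G).
Proof. exact: (@initial_continuous (set_type H) G set_val). Qed.

Lemma subgroup_nbhs (x : S) (U : set S) : nbhs x U ->
  exists V : set G, [/\ open V, V (val x) & forall s : S, V (val s) -> U s].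
Proof.
rewrite nbhsE => -[B [oB Bx] BU].
have [V oV VB] : exists2 V : set G, open V & (val : S -> G) @^-1` V = B := oB.
exists V; split => //; first by rewrite -VB in Bx.
by move=> s Vs; apply: BU; rewrite -VB.
Qed.

Lemma subgroup_compact (K : set G) : closed H -> compact K ->
  compact ((val : S -> G) @^-1` K).
Proof.
move=> clH cK; have [hG _ _] := lcscG.
have : compact (K `&` H).
  by apply: compact_closedI.
move=> /compact_near_coveringP ncK; apply/compact_near_coveringP.
move=> I F P FF near_P.
have : \forall i \near F, K `&` H `<=` (fun y => forall s : S, val s = y -> P i s).
  apply: ncK => y [Ky Hy].
  pose x : S := Sub y (mem_set Hy).
  have vx : val x = y by exact: SubK.
  have Kx : K (val x) by rewrite vx.
  have [[U FU] [/= nU FFU] UP] := near_P x Kx.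
  have [V [oV Vx VU]] := subgroup_nbhs nU.
  exists (V, FU).
    by split => //=; apply: open_nbhs_nbhs; rewrite -vx.
  move=> [z i] [/= Vz FUi] s sz; apply: (UP (s, i)); split => //=.
  by apply: VU; move: Vz; rewrite -sz.
apply: filterS => i HP s Ks; apply: HP erefl; split => //.
exact/set_mem/(valP s).
Qed.

Lemma subgroup_lcsc : closed H -> lcsc S.
Proof.
move=> clH; have [hG lcG scG] := lcscG; split.
- move=> p q pq; apply/val_inj/hG => A D nA nD.
  have [s [As Ds]] := pq _ _ (val_continuous nA) (val_continuous nD).
  by exists (val s).
- move=> x _; have [K [nK cK]] := lc_nbhs (val x) lcG.
  exists ((val : S -> G) @^-1` K).
    have nvK : nbhs x ((val : S -> G) @^-1` K) := val_continuous nK.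
    by rewrite /within /=; move: nvK; apply: filterS => y Ky _.
  split; first exact: subgroup_compact.
  apply: closed_comp; last exact: compact_closed.
  by move=> s _; exact: val_continuous.
- have [b [bo bx]] := second_countableP scG.
  exists (range (fun n => (val : S -> G) @^-1` b n)).
    exact: card_image_le.
  split.
    move=> _ [n _ <-]; apply: open_comp => // s _; exact: val_continuous.
  move=> x U nU; have [V [oV Vx VU]] := subgroup_nbhs nU.
  have [n [bnx bnV]] := bx (val x) V (open_nbhs_nbhs (conj oV Vx)).
  exists ((val : S -> G) @^-1` b n) => /=; first by split => //; exists n.
  by move=> s bs; apply: VU; exact: bnV.
Qed.

End subgroup_topology.

Section closed_subgroups.
Context (R : realType) (G : topGroupType) (lcscG : lcsc G).
Variables (W K0 : set G) (C0 : R).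
Hypothesis hd : harnack_data W K0 C0.
Context (H : set G) (sgH : subgroup H) (clH : closed H).
Local Notation S := (subgroup_type sgH).
Local Notation v := (val : S -> G).
Local Open Scope ereal_scope.

Let lcscS : lcsc S. Proof. exact: subgroup_lcsc. Qed.
Let scS : @second_countable S. Proof. by case: lcscS. Qed.
Let v1 : v 1%g = 1%g. Proof. exact: val1. Qed.
Let vM (x y : S) : v (x * y)%g = (v x * v y)%g. Proof. exact: valM. Qed.
Let vX (x : S) n : v (x ^+ n)%g = (v x ^+ n)%g.
Proof. by elim: n => [|n IH]; rewrite ?expg0// !expgS vM IH. Qed.
Let scG : @second_countable G. Proof. by case: lcscG. Qed.

Variable m : {measure set (borel S) -> \bar R}.
Hypothesis hm : haar m.

(** The Harnack inequality for h^n is integrated over the subgroup against m: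
the integral I of s (W^2 x^-1) becomes c^n I after translation by h^n. It is
positive since s >= 1 near 1. It is finite because, by Fubini's theorem, it is
the s-integral in y of the m-mass of the x with y x in W^2, and two such x
differ on the left by an element of W^4. *)
Lemma modular_le1 (h : S) (c : R) : (0 < c)%R ->
  (forall E : set (borel S), measurable E -> m (rtrans E h) = c%:E * m E) -> (c <= 1)%R.
Proof.
move=> c0 mc.
have [[oW W1 Wi] cK0 WK0 C00 hC] := hd.
have oWn n : open (setpow W n.+1) by exact: setpow_open.
have [sm smE] := sigma_finite_measure_ex (haar_sigma_finite lcscS hm).
have oL n : open (v @^-1` setpow W n.+1).
  by apply: open_comp => // s _; exact: val_continuous.
have L1 : (v @^-1` setpow W 2) 1%g.
  by change (setpow W 2 (v 1%g)); rewrite v1; apply: (@setpow_le _ _ 0).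
have cn n E : measurable (E : set (borel S)) ->
    m (rtrans E (h ^+ n)%g) = (c ^+ n)%:E * m E.
  elim: n E => [|n IH] E mE; first by rewrite expg0 rtrans1 expr0 mul1e.
  rewrite expgS -rtransM mc; last exact: measurable_rtrans.
  by rewrite IH// exprS EFinM muleA.
have bound n : (c ^+ n <= C0)%R.
  have [s [sC s1]] := hC (v h ^+ n)%g.
  pose I := \int[sm]_x s (rtrans (setpow W 2) (v x)).
  have ms : measurable_fun [set: borel S] (fun x : borel S => s (rtrans (setpow W 2) (v x))).
    have mr := measurable_fun_rtrans lcscG s (oWn 1%N).
    exact: (measurableT_comp mr (continuous_borel (@val_continuous _ _ sgH))).
  have mL : measurable (v @^-1` setpow W 2 : set (borel S)) by exact: open_borel.
  have I0 : 0 < I.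
    apply: (@lt_le_trans _ _ (m (v @^-1` setpow W 2))).
      by apply: (haar_open_gt0 lcscS hm) => //; exists 1%g.
    rewrite -smE.
    have -> : sm (v @^-1` setpow W 2) = \int[sm]_x (\1_(v @^-1` setpow W 2) x)%:E.
      by rewrite integral_indic// setIT.
    apply: ge0_le_integral => //.
    - exact/measurable_EFinP.
    - move=> x _; have [Lx|Lx] := pselect ((v @^-1` setpow W 2) x); last first.
        by rewrite indicE memNset//=; exact: measure_ge0.
      rewrite indicE mem_set//; apply: s1; first exact: open_rtrans.
      by rewrite /rtrans /= mul1g.
  pose P : set (S * G) := [set p | setpow W 2 (p.2 * v p.1)%g].
  have oP : open P.
    apply: (@open_comp _ _ (fun p : S * G => p.2 * v p.1)%g) => // p _.
    apply: cvgMg; first exact: cvg_snd.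
    apply: (@continuous_comp _ _ _ fst v); first exact: cvg_fst.
    exact: val_continuous.
  have IE : I = \int[s]_y m [set x | P (x, y)].
    transitivity (\int[sm]_x s [set y | P (x, y)]); first by [].
    by rewrite (fubini_open scS scG)//; apply: eq_integral => y _; exact: smE.
  have secP y : open [set x | P (x, y)].
    apply: (@open_comp S (S * G)%type (fun x : S => (x, y)) P) => // x _.
    by apply: (@cvg_pair _ _ _ (nbhs x) (nbhs x) (nbhs y)); [exact: cvg_id|exact: cvg_cst].
  have mPm : measurable_fun [set: borel G] (fun y : borel G => m [set x | P (x, y)]).
    have oP' : open [set p : G * S | P (p.2, p.1)].
      apply: (@open_comp (G * S)%type (S * G)%type (fun p => (p.2, p.1)) P) => // p _.
      by apply: (@cvg_pair _ _ _ (nbhs p) (nbhs p.2) (nbhs p.1)); [exact: cvg_snd|exact: cvg_fst].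
    have := @measurable_section1 R G S scG scS sm _ oP'.
    by congr (measurable_fun _ _); apply/funext => y; exact: smE.
  have cK : compact (v @^-1` K0) by exact: subgroup_compact.
  have mK : m (v @^-1` K0) \is a fin_num.
    by rewrite ge0_fin_numE//; case: hm => _ + _; exact.
  have Ioo : I < +oo.
    rewrite IE; apply: (@le_lt_trans _ _ (m (v @^-1` K0) * s setT)); last first.
      rewrite -(fineK mK) -[s setT]fineK; last exact: fin_num_measure.
      by rewrite -EFinM ltry.
    rewrite -integral_cst//; apply: ge0_le_integral => //.
    - move=> y _ /=; have [[x0 Px0]|nx] := pselect (exists x, P (x, y)); last first.
        rewrite (_ : [set x | P (x, y)] = set0) ?measure0//.
        by apply/seteqP; split => // x Px; apply: nx; exists x.
      have [li _ _] := hm.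
      rewrite -(li x0); last exact: open_borel.
      apply: le_measure; rewrite ?inE.
      + by apply: measurable_ltrans; exact: open_borel.
      + exact: (compact_borel lcscS).
      + move=> x Px.
        have {}Px : setpow W 2 (y * (v x0 * v x))%g by rewrite -vM; exact: Px.
        apply: WK0.
        apply: (setpow_le W1 (isT : (4 <= 8)%N)).
        have -> : v x = ((y * v x0)^-1 * (y * (v x0 * v x)))%g.
          by rewrite invgM !mulgA mulgVK mulVg mul1g.
        by apply: (@setpowM _ _ 2 2) => //; exact: setpowV.
  have Ih : \int[sm]_x s (rtrans (setpow W 2) (v x * v h ^+ n)%g) = (c ^+ n)%:E * I.
    transitivity (\int[sm]_x s [set y | P ((x * h ^+ n)%g, y)]).
      apply: eq_integral => x _.
      by have -> : (v x * v h ^+ n)%g = v (x * h ^+ n)%g by rewrite vM vX.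
    have oPn : open [set p : S * G | P ((p.1 * h ^+ n)%g, p.2)].
      apply: (@open_comp (S * G)%type (S * G)%type
        (fun p => ((p.1 * h ^+ n)%g, p.2)) P) => // p _.
      apply: (@cvg_pair _ _ _ (nbhs p) (nbhs (p.1 * h ^+ n)%g) (nbhs p.2)); last exact: cvg_snd.
      by apply: cvgMg; [exact: cvg_fst|exact: cvg_cst].
    rewrite (fubini_open scS scG sm s oPn) IE -ge0_integralZl//; last first.
      by rewrite lee_fin exprn_ge0// ltW.
    apply: eq_integral => y _; rewrite -cn; last by apply: open_borel; exact: secP.
    exact: smE.
  have : \int[sm]_x s (rtrans (setpow W 2) (v x * v h ^+ n)%g) <= C0%:E * I.
    rewrite -ge0_integralZl//; last by rewrite lee_fin ltW.
    apply: ge0_le_integral => //.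
    - have := @measurable_mulr R S (fun x : borel S => s (rtrans (setpow W 2) (v x))) (h ^+ n)%g ms.
      congr (measurable_fun _ _); apply/funext => x.
      by have -> : (v x * v h ^+ n)%g = v (x * h ^+ n)%g by rewrite vM vX.
    - by apply: measurable_funeM.
  rewrite Ih.
  have If : I \is a fin_num by rewrite ge0_fin_numE// ltW.
  have fI0 : (0 < fine I)%R by rewrite fine_gt0// I0 Ioo.
  by rewrite -(fineK If) -!EFinM lee_fin ler_pM2r.
rewrite leNgt; apply/negP => c1.
have [n] : exists n, (C0 < c ^+ n)%R.
  have e0 : (0 < c - 1)%R by rewrite subr_gt0.
  pose n := (Num.trunc (C0 / (c - 1))%R).+1.
  exists n; have : (C0 / (c - 1) < n%:R)%R by rewrite truncnS_gt.
  rewrite ltr_pdivrMr// => /lt_le_trans; apply.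
  elim: n => [|k IH]; first by rewrite mul0r.
  rewrite exprS -natr1 mulrDl mul1r.
  have ck : (1 <= c ^+ k)%R by rewrite exprn_ege1// ltW.
  nra.
by rewrite ltNge bound.
Qed.

Lemma haar_right_invariant : right_invariant m.
Proof.
move=> h E mE.
have [c c0 mc] := haar_modular lcscS h hm.
have [c' c'0 mc'] := haar_modular lcscS h^-1%g hm.
have T0 : 0 < m (v @^-1` W).
  have [[oW W1 _] _ _ _ _] := hd.
  apply: (haar_open_gt0 lcscS hm); last by exists 1%g; change (W (v 1%g)); rewrite v1.
  by apply: open_comp => // s _; exact: val_continuous.
have -> : [set (x * h)%g | x in E] = rtrans E h^-1%g.
  apply/seteqP; split => [_ [x Ex <-]|x Ex]; first by rewrite /rtrans /= mulgK.
  by exists (x * h^-1)%g => //; rewrite mulgVK.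
rewrite mc'//.
have le1 := modular_le1 c0 mc; have le1' := modular_le1 c'0 mc'.
have [[oW W1 _] cK0 WK0 _ _] := hd.
have oT : open (v @^-1` W).
  by apply: open_comp => // s _; exact: val_continuous.
have mT : measurable (v @^-1` W : set (borel S)) by exact: open_borel.
have Tfin : m (v @^-1` W) \is a fin_num.
  rewrite ge0_fin_numE//; apply: (haar_lty lcscS hm oT (K := v @^-1` K0)).
    exact: subgroup_compact.
  by move=> x Wx; apply: WK0; apply: (setpow_le W1 (isT : (1 <= 8)%N)); exact: setpow1.
have cc : m (v @^-1` W) = c'%:E * (c%:E * m (v @^-1` W)).
  rewrite -mc// -mc'; last exact: measurable_rtrans.
  by rewrite rtransM mulVg rtrans1.
have {}cc : (c' * c = 1)%R.
  move: cc; rewrite -(fineK Tfin) -!EFinM mulrA => -[] /esym.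
  rewrite -[X in _ = X]mul1r => /mulIf; apply.
  by rewrite gt_eqF// fine_gt0// T0 ltey_eq Tfin.
have -> : c' = 1%R.
  apply/eqP; rewrite eq_le le1' /= -cc.
  by rewrite ler_piMr// ltW.
by rewrite mul1e.
Qed.

End closed_subgroups.

Theorem corollary4 (R : realType) (G : topGroupType) (lcscG : lcsc G)
    (recG : recurrent_group R G) :
  (forall (H : set G) (sgH : subgroup H), closed H ->
     unimodular R (subgroup_type sgH)) /\
  (forall g : G, closed (contracted g) -> contracted g = [set 1%g]).
Proof.
have [W [K0 [C hd]]] := group_harnack lcscG recG.
split=> [H sgH clH m hm|g]; last exact: (contracted_trivial lcscG hd).
exact: (haar_right_invariant lcscG hd clH (left_haarP hm)).
Qed.
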